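(* Let $\rho=\rho(\epsilon)$ be defined in the asymptotic range $\epsilon^3\ll\rho\leq\epsilon^2$ and let ${\bf a}_0\in\ell^2(\mathbb{Z})$ be fixed independently of $\epsilon$. For every $\tau_0>0$, there is a small $\epsilon_0>0$ and positive constants $C_0$ and $C$ (independent of $\epsilon$) such that for every $\epsilon\in(0,\epsilon_0)$ for which the initial data satisfies $$\|\xi(0)-{\bf X}(0)\|_{\ell^2}+\|\dot{\xi}(0)-\dot{\bf X}(0)\|_{\ell^2}\leq C_0\,\rho^{-1}\epsilon^3,$$ the solution $\xi(t)$ of the discrete Klein--Gordon equation $$\ddot{\xi}_j+\xi_j+\rho\,\xi_j^3=\epsilon(\xi_{j+1}+\xi_{j-1}),\qquad j\in\mathbb{Z},$$ satisfies, for every $t\in[-\tau_0\rho^{-1},\tau_0\rho^{-1}]$, $$\|\xi(t)-{\bf X}(t)\|_{\ell^2}+\|\dot{\xi}(t)-\dot{\bf X}(t)\|_{\ell^2}\leq C\,\rho^{-1}\epsilon^3.$$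
   Context: Here $\xi(t)=\{\xi_j(t)\}_{j\in\mathbb{Z}}$ is real-valued with $\xi(t),\dot\xi(t)\in\ell^2(\mathbb{Z})$, and dots on $\xi$ and ${\bf X}$ denote $d/dt$. The notation $\epsilon^3\ll\rho\le\epsilon^2$ means that $\rho=\rho(\epsilon)>0$ satisfies $\rho\leq\epsilon^2$ and $\epsilon^3/\rho\to0$ as $\epsilon\to0^+$. Set $\delta=\rho/\epsilon^2$ and let ${\bf a}(\tau)=\{a_j(\tau)\}_{j\in\mathbb{Z}}$, $a_j(\tau)\in\mathbb{C}$, be the global solution in $\ell^2(\mathbb{Z})$ of the generalized discrete nonlinear Schr\''odinger equation $$2i\dot a_j+3\epsilon\delta|a_j|^2a_j=a_{j+1}+a_{j-1}+\frac{\epsilon}{4}\left(a_{j+2}+2a_j+a_{j-2}\right),\qquad j\in\mathbb{Z},$$ with ${\bf a}(0)={\bf a}_0$, where the dot on $a_j$ is the derivative in the slow time $\tau=\epsilon t$. The leading-order approximation ${\bf X}(t)=\{X_j(t)\}_{j\in\mathbb{Z}}$ is $$X_j(t)=a_j(\epsilon t)e^{it}+\bar a_j(\epsilon t)e^{-it}+\tfrac18\rho\left(a_j^3(\epsilon t)e^{3it}+\bar a_j^3(\epsilon t)e^{-3it}\right).$$ *)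

(* Defs.v *)
From Stdlib Require Import Reals ZArith Lra.
From Coquelicot Require Import Coquelicot.
Open Scope R_scope.

(* Square-summability over Z.  All terms are nonnegative, so pairing the indices
   n and -n-1 (n : nat) enumerates Z without affecting convergence or the sum. *)
Definition ell2_term {V : NormedModule R_AbsRing} (x : Z -> V) (n : nat) : R :=
  norm (x (Z.of_nat n)) ^ 2 + norm (x (- Z.of_nat n - 1)%Z) ^ 2.

Definition ell2 {V : NormedModule R_AbsRing} (x : Z -> V) : Prop :=
  ex_series (ell2_term x).

(* Meaningful only when [ell2 x] holds: [Series] is a total operator. *)
Definition ell2_norm {V : NormedModule R_AbsRing} (x : Z -> V) : R :=
  sqrt (Series (ell2_term x)).

(* Differentiability at t, with derivative v, of x as a map into ell^2(Z; V):
   the difference quotients converge to v in the ell^2 norm, not just entrywise. *)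
Definition is_ell2_derive {V : NormedModule R_AbsRing}
    (x : R -> Z -> V) (t : R) (v : Z -> V) : Prop :=
  locally t (fun s => ell2 (x s)) /\
  ell2 v /\
  is_lim (fun h => ell2_norm (fun j =>
            minus (scal (/ h) (minus (x (t + h) j) (x t j))) (v j))) 0 0.

Definition dot (x : R -> Z -> R) : R -> Z -> R :=
  fun t j => Derive (fun s => x s j) t.

Definition expi (t : R) : C := (cos t, sin t).

(* The norm of [C_R_NormedModule] is the complex modulus. *)
Lemma norm_C_R (z : C) : norm (V := C_R_NormedModule) z = Cmod z.
Proof.
  unfold norm; simpl; unfold prod_norm, Cmod, norm; simpl.
  unfold abs; simpl.
  f_equal; rewrite !Rmult_1_r, <- !Rabs_mult, !Rabs_pos_eq; auto using Rle_0_sqr.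
  all: apply Rle_0_sqr.
Qed.

Definition solves_gdNLS (eps delta : R) (a0 : Z -> C) (a : R -> Z -> C) : Prop :=
  (forall j : Z, a 0 j = a0 j) /\
  forall tau : R, exists a' : Z -> C,
    is_ell2_derive (V := C_R_NormedModule) a tau a' /\
    forall j : Z,
      (2 * Ci * a' j + RtoC (3 * eps * delta * Cmod (a tau j) ^ 2) * a tau j
       = a tau (j + 1)%Z + a tau (j - 1)%Z
         + RtoC (eps / 4) * (a tau (j + 2)%Z + 2 * a tau j + a tau (j - 2)%Z))%C.

(* Solutions with (xi, dot xi) in ell^2 on the time interval (-T, T). *)
Definition solves_dKG (eps rho T : R) (xi : R -> Z -> R) : Prop :=
  forall t : R, Rabs t < T ->
    is_ell2_derive (V := R_NormedModule) xi t (dot xi t) /\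
    is_ell2_derive (V := R_NormedModule) (dot xi) t (dot (dot xi) t) /\
    forall j : Z,
      dot (dot xi) t j + xi t j + rho * xi t j ^ 3
      = eps * (xi t (j + 1)%Z + xi t (j - 1)%Z).

Definition leading_approx_C (eps rho : R) (a : R -> Z -> C) (t : R) (j : Z) : C :=
  let z := a (eps * t) j in
  (z * expi t + Cconj z * expi (- t)
   + RtoC (rho / 8) * (z * z * z * expi (3 * t)
                       + Cconj z * Cconj z * Cconj z * expi (- (3 * t))))%C.

Definition leading_approx (eps rho : R) (a : R -> Z -> C) (t : R) (j : Z) : R :=
  Re (leading_approx_C eps rho a t j).

(* Taking the real part above loses nothing. *)
Lemma leading_approx_real (eps rho : R) (a : R -> Z -> C) (t : R) (j : Z) :
  leading_approx_C eps rho a t j = RtoC (leading_approx eps rho a t j).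
Proof.
  unfold leading_approx, leading_approx_C; cbv zeta.
  destruct (a (eps * t) j) as [x y].
  apply injective_projections; [reflexivity|].
  unfold expi, Cconj, RtoC; simpl; rewrite !cos_neg, !sin_neg; ring.
Qed.

(* eps^3 << rho <= eps^2 as eps -> 0+. *)
Definition asymptotic_range (rho : R -> R) : Prop :=
  at_right 0 (fun eps => 0 < rho eps /\ rho eps <= eps ^ 2) /\
  filterlim (fun eps => eps ^ 3 / rho eps) (at_right 0) (locally 0).

(* Main.v *)
(** Write [z_j(t) = a_j(eps t) e^{it} = u_j + i v_j].  By gauge invariance [(u, v)]
    solves an autonomous system, it conserves [|u|^2 + |v|^2], and
    [X = 2u + (rho/4) Re z^3] satisfies the Klein-Gordon equation up to [O(eps^3)] in
    [l^2].  For the errors [y] of the position and [w] of the velocity, the energy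
    [E = |w|^2 + |y|^2 - eps <y, A y>], with [A] the nearest-neighbour coupling, is
    equivalent to [|w|^2 + |y|^2] and, with [eta = eps^3 / rho], obeys
    [|E'| <= k rho (eta^2 + E) (1 + E)].  This inequality separates, so over times of
    order [1/rho] the energy stays [O(eta^2)]. *)
Require Import Defs.
From Stdlib Require Import Reals ZArith Lra Lia FunctionalExtensionality.
From Coquelicot Require Import Coquelicot.
Open Scope R_scope.

(** * Summation over Z *)

(** Times of order [1/rho] are at least of order [eps^-2], so a growth rate of order [eps], which
    the coupling would contribute to the plain norm of the errors, would be fatal. The term
    [- eps <y, A y>] removes this contribution exactly because [A] is self-adjoint. Only rates of
    order [rho] remain, and a residual of size [eps^3 = rho * eta] then accumulates to [eta].

    The velocity error is measured against a truncation of the derivative of [X] that omits its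
    terms of order [rho * eps]. The errors thus solve a first-order system with one residual in each
    equation, and [X] is never differentiated twice; the omitted part is restored at the end, at a
    cost of order [eps^3].

    All constants must be chosen before [eps]. The residuals are polynomial in [u], [v] and their
    neighbours, with coefficients bounded because [eps] and [delta = rho / eps^2] are at most one.
    As [l^2] is an algebra and the conserved norm is fixed by the initial data, one bound serves all
    times and all [eps]. *)

Definition zpair (f : Z -> R) (n : nat) : R :=
  f (Z.of_nat n) + f (- Z.of_nat n - 1)%Z.
(** The absolute values sit inside the pairs: otherwise cancellation between the members of a pair
    could hide divergence, and translation, which breaks up the pairs, would not preserve the
    notion. *)
Definition summable (f : Z -> R) : Prop := ex_series (zpair (fun j => Rabs (f j))).
Definition sumZ (f : Z -> R) : R := Series (zpair f).

Definition sadd (x y : Z -> R) : Z -> R := fun j => x j + y j.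
Definition smul (x y : Z -> R) : Z -> R := fun j => x j * y j.
Definition sscal (c : R) (x : Z -> R) : Z -> R := fun j => c * x j.
Definition translate (k : Z) (x : Z -> R) : Z -> R := fun j => x (j + k)%Z.

Ltac seq_ring :=
  apply functional_extensionality; intro; unfold sadd, smul, sscal; ring.

Lemma summable_ex f : summable f -> ex_series (zpair f).
Proof.
  intro H; apply (ex_series_le (V := R_CompleteNormedModule)) with (2 := H).
  intro n; unfold zpair, norm; simpl; unfold abs; simpl; apply Rabs_triang.
Qed.

Lemma summable_le f g : (forall j, Rabs (f j) <= g j) -> summable g -> summable f.
Proof.
  intros Hle H; apply (ex_series_le (V := R_CompleteNormedModule)) with (2 := H).
  intro n; unfold zpair, norm; simpl; unfold abs; simpl.
  rewrite Rabs_pos_eq by (apply Rplus_le_le_0_compat; apply Rabs_pos).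
  apply Rplus_le_compat; apply Rle_trans with (1 := Hle _), Rle_abs.
Qed.

Lemma summable_plus f g : summable f -> summable g -> summable (sadd f g).
Proof.
  intros Hf Hg.
  apply summable_le with (g := sadd (fun j => Rabs (f j)) (fun j => Rabs (g j))).
  - intro j; apply Rabs_triang.
  - eapply ex_series_ext; [|apply (ex_series_plus _ _ Hf Hg)].
    intro n; unfold zpair, sadd, plus; simpl.
    repeat rewrite (Rabs_pos_eq (Rabs _ + Rabs _)); try lra;
      apply Rplus_le_le_0_compat; apply Rabs_pos.
Qed.

Lemma summable_scal c f : summable f -> summable (sscal c f).
Proof.
  intro Hf; eapply ex_series_ext; [|apply (ex_series_scal (Rabs c) _ Hf)].
  intro n; unfold zpair, sscal, scal; simpl; unfold mult; simpl.
  rewrite !Rabs_mult; ring.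
Qed.

Lemma sumZ_plus f g : summable f -> summable g -> sumZ (sadd f g) = sumZ f + sumZ g.
Proof.
  intros Hf Hg; unfold sumZ.
  rewrite <- Series_plus by now apply summable_ex.
  apply Series_ext; intro n; unfold zpair, sadd; ring.
Qed.

Lemma sumZ_scal c f : sumZ (sscal c f) = c * sumZ f.
Proof.
  unfold sumZ; rewrite <- Series_scal_l.
  apply Series_ext; intro n; unfold zpair, sscal; ring.
Qed.

Lemma sumZ_le f g : (forall j, f j <= g j) -> summable f -> summable g -> sumZ f <= sumZ g.
Proof.
  intros Hle Hf Hg.
  assert (H : 0 <= Series (fun n => zpair g n - zpair f n)).
  { rewrite <- (Rmult_0_l (Series (zpair f))), <- Series_scal_l.
    apply Series_le.
    - intro n; unfold zpair; split; [lra|].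
      generalize (Hle (Z.of_nat n)) (Hle (- Z.of_nat n - 1)%Z); lra.
    - apply (ex_series_minus (V := R_NormedModule)); now apply summable_ex. }
  rewrite Series_minus in H by now apply summable_ex.
  unfold sumZ; lra.
Qed.

Lemma sumZ_nonneg f : (forall j, 0 <= f j) -> summable f -> 0 <= sumZ f.
Proof.
  intros Hf H.
  replace 0 with (sumZ (sscal 0 f)) by (rewrite sumZ_scal; ring).
  apply sumZ_le; trivial; [|now apply summable_scal].
  intro j; unfold sscal; rewrite Rmult_0_l; apply Hf.
Qed.

Lemma summable_cv0 f : summable f ->
  is_lim_seq (fun n => f (Z.of_nat n)) 0 /\ is_lim_seq (fun n => f (- Z.of_nat n - 1)%Z) 0.
Proof.
  intro H; apply ex_series_lim_0 in H.
  split; apply is_lim_seq_abs_0;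
    refine (is_lim_seq_le_le (fun _ => 0) _ _ 0 _ (is_lim_seq_const 0) H);
    intro n; unfold zpair; split; try apply Rabs_pos.
  - generalize (Rabs_pos (f (- Z.of_nat n - 1)%Z)); lra.
  - generalize (Rabs_pos (f (Z.of_nat n))); lra.
Qed.

(** The pairs up to [N] cover the window from [-N-1] to [N]. Translation by one moves the window: it
    gains the entry [N+1] and loses the entry [-N-1], and both vanish in the limit for a summable
    [f]. *)
Lemma sum_zpair_shift f N :
  sum_n (zpair (translate 1 f)) N
  = sum_n (zpair f) N + f (Z.of_nat (S N)) - f (- Z.of_nat N - 1)%Z.
Proof.
  induction N as [|N IH].
  - rewrite !sum_O; unfold zpair, translate.
    replace (Z.of_nat 0 + 1)%Z with (Z.of_nat 1) by lia.
    replace (- Z.of_nat 0 - 1 + 1)%Z with (Z.of_nat 0) by lia.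
    match goal with |- ?a = ?b => change (@eq R a b) end; ring.
  - rewrite !sum_Sn, IH.
    change (@plus R_AbelianMonoid) with Rplus; unfold zpair, translate.
    replace (Z.of_nat (S N) + 1)%Z with (Z.of_nat (S (S N))) by lia.
    replace (- Z.of_nat (S N) - 1 + 1)%Z with (- Z.of_nat N - 1)%Z by lia.
    match goal with |- ?a = ?b => change (@eq R a b) end; ring.
Qed.

Lemma is_sumZ_shift f l : 
  is_lim_seq (fun n => f (Z.of_nat n)) 0 -> is_lim_seq (fun n => f (- Z.of_nat n - 1)%Z) 0 ->
  is_series (zpair f) l -> is_series (zpair (translate 1 f)) l.
Proof.
  intros H1 H2 H.
  change (is_lim_seq (sum_n (zpair (translate 1 f))) l).
  eapply is_lim_seq_ext; [intro n; symmetry; apply sum_zpair_shift|].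
  replace (Finite l) with (Finite (l + 0 - 0)) by (f_equal; ring).
  apply is_lim_seq_minus'; [apply is_lim_seq_plus'|]; trivial.
  apply (is_lim_seq_incr_1 (fun n => f (Z.of_nat n))); trivial.
Qed.

Lemma summable_shift1 f : summable f -> summable (translate 1 f).
Proof.
  intro H; destruct (summable_cv0 _ H) as [H1 H2].
  destruct H as [l H]; exists l.
  change (is_series (zpair (translate 1 (fun j => Rabs (f j)))) l).
  apply is_sumZ_shift; trivial;
    rewrite <- Rabs_R0; apply (is_lim_seq_abs _ 0); trivial.
Qed.

Lemma sumZ_shift1 f : summable f -> sumZ (translate 1 f) = sumZ f.
Proof.
  intro H; destruct (summable_cv0 _ H) as [H1 H2].
  apply is_series_unique, is_sumZ_shift; trivial.
  apply Series_correct, summable_ex, H.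
Qed.

(** The reflection [j -> -j-1] swaps the members of each pair. It also conjugates the two unit
    translations, so results for one transfer to the other. *)
Lemma sumZ_flip f : sumZ (fun j => f (- j - 1)%Z) = sumZ f.
Proof.
  apply Series_ext; intro n; unfold zpair.
  replace (- (- Z.of_nat n - 1) - 1)%Z with (Z.of_nat n) by lia; ring.
Qed.

Lemma summable_flip f : summable f -> summable (fun j => f (- j - 1)%Z).
Proof.
  intro H; eapply ex_series_ext; [|exact H]; intro n; unfold zpair; simpl.
  replace (- (- Z.of_nat n - 1) - 1)%Z with (Z.of_nat n) by lia; ring.
Qed.

Lemma shift_opp1_flip f :
  translate (-1) f = (fun j => translate 1 (fun j => f (- j - 1)%Z) (- j - 1)%Z).
Proof.
  apply functional_extensionality; intro j; unfold translate; f_equal; lia.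
Qed.

Lemma summable_shift_1 f : summable f -> summable (translate (-1) f).
Proof.
  intro H; rewrite shift_opp1_flip.
  apply (summable_flip (translate 1 (fun j => f (- j - 1)%Z))).
  now apply summable_shift1, summable_flip.
Qed.

Lemma sumZ_shift_1 f : summable f -> sumZ (translate (-1) f) = sumZ f.
Proof.
  intro H; rewrite shift_opp1_flip.
  rewrite (sumZ_flip (translate 1 (fun j => f (- j - 1)%Z))).
  rewrite sumZ_shift1 by now apply summable_flip.
  apply sumZ_flip.
Qed.

Lemma sumZ_term_le f j : (forall j, 0 <= f j) -> summable f -> f j <= sumZ f.
Proof.
  intros Hf H.
  assert (Hn : forall n, zpair f n <= sumZ f).
  { intro n.
    assert (Hs : forall m, 0 <= zpair f m)
      by (intro m; apply Rplus_le_le_0_compat; apply Hf).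
    apply Rle_trans with (sum_n (zpair f) n).
    - destruct n; [rewrite sum_O; apply Rle_refl|].
      rewrite sum_Sn; unfold plus; simpl.
      assert (0 <= sum_n (zpair f) n); [|lra].
      induction n as [|n IH]; [rewrite sum_O; apply Hs|].
      rewrite sum_Sn; apply Rplus_le_le_0_compat; trivial.
    - apply (is_lim_seq_incr_compare (sum_n (zpair f))).
      + apply (Series_correct (zpair f)), summable_ex, H.
      + intro m; rewrite sum_Sn; unfold plus; simpl; generalize (Hs (S m)); lra. }
  destruct (Z_le_gt_dec 0 j) as [Hj|Hj].
  - apply Rle_trans with (2 := Hn (Z.to_nat j)); unfold zpair.
    rewrite Z2Nat.id by lia; generalize (Hf (- j - 1)%Z); lra.
  - apply Rle_trans with (2 := Hn (Z.to_nat (- j - 1))); unfold zpair.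
    rewrite Z2Nat.id by lia; replace (- (- j - 1) - 1)%Z with j by lia.
    generalize (Hf (- j - 1)%Z); lra.
Qed.
(** * The inner product and the pointwise product on l2(Z) *)

Notation l2 := (ell2 (V := R_NormedModule)).
Notation nrm := (ell2_norm (V := R_NormedModule)).
Definition ip (x y : Z -> R) : R := sumZ (smul x y).

Lemma ell2_term_zpair (x : Z -> R) n :
  ell2_term (V := R_NormedModule) x n = zpair (smul x x) n.
Proof.
  unfold ell2_term, zpair, smul, norm; simpl; unfold abs; simpl.
  rewrite !Rmult_1_r, <- !Rabs_mult, !Rabs_pos_eq; auto; apply Rle_0_sqr.
Qed.

Lemma l2_summable x : l2 x <-> summable (smul x x).
Proof.
  split; apply ex_series_ext; intro n; rewrite ell2_term_zpair; unfold zpair, smul;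
    rewrite !(Rabs_pos_eq (_ * _)); auto; apply Rle_0_sqr.
Qed.

Lemma nrm_sqrt x : nrm x = sqrt (ip x x).
Proof.
  unfold ell2_norm, ip, sumZ; f_equal; apply Series_ext, ell2_term_zpair.
Qed.

Lemma nrm_pos x : 0 <= nrm x.
Proof. apply sqrt_pos. Qed.

Lemma l2_mul_summable x y : l2 x -> l2 y -> summable (smul x y).
Proof.
  rewrite !l2_summable; intros Hx Hy.
  apply summable_le with (g := sadd (smul x x) (smul y y)).
  - intro j; unfold sadd, smul; apply Rabs_le; nra.
  - now apply summable_plus.
Qed.

Lemma ip_pos x : l2 x -> 0 <= ip x x.
Proof.
  intro H; apply sumZ_nonneg; [intro; apply Rle_0_sqr | now apply l2_summable].
Qed.

Lemma nrm_sq x : l2 x -> nrm x ^ 2 = ip x x.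
Proof. intro H; rewrite nrm_sqrt; apply pow2_sqrt, ip_pos, H. Qed.

Lemma l2_add x y : l2 x -> l2 y -> l2 (sadd x y).
Proof.
  intros Hx Hy; apply l2_summable.
  replace (smul (sadd x y) (sadd x y))
    with (sadd (smul x x) (sadd (sscal 2 (smul x y)) (smul y y))) by seq_ring.
  repeat first [apply summable_plus | apply summable_scal | apply l2_mul_summable]; trivial.
Qed.

Lemma l2_scal c x : l2 x -> l2 (sscal c x).
Proof.
  intros Hx; apply l2_summable.
  replace (smul (sscal c x) (sscal c x)) with (sscal (c * c) (smul x x)) by seq_ring.
  now apply summable_scal, l2_mul_summable.
Qed.

Lemma ip_comm x y : ip x y = ip y x.
Proof. unfold ip; f_equal; seq_ring. Qed.

Lemma ip_add_l x y z : l2 x -> l2 y -> l2 z -> ip (sadd x y) z = ip x z + ip y z.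
Proof.
  intros; unfold ip; rewrite <- sumZ_plus by now apply l2_mul_summable.
  f_equal; seq_ring.
Qed.

Lemma ip_add_r x y z : l2 x -> l2 y -> l2 z -> ip z (sadd x y) = ip z x + ip z y.
Proof. intros; rewrite ip_comm, ip_add_l, (ip_comm x), (ip_comm y); trivial. Qed.

Lemma ip_scal_l c x y : ip (sscal c x) y = c * ip x y.
Proof. unfold ip; rewrite <- sumZ_scal; f_equal; seq_ring. Qed.

Lemma ip_scal_r c x y : ip y (sscal c x) = c * ip y x.
Proof. rewrite ip_comm, ip_scal_l, (ip_comm x); trivial. Qed.

Lemma ip_quadratic x y s : l2 x -> l2 y ->
  0 <= ip x x + 2 * s * ip x y + s ^ 2 * ip y y.
Proof.
  intros Hx Hy.
  generalize (ip_pos _ (l2_add _ _ Hx (l2_scal s _ Hy))).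
  rewrite ip_add_l, !ip_add_r, !ip_scal_l, !ip_scal_r, (ip_comm y x)
    by auto using l2_add, l2_scal.
  lra.
Qed.

Lemma cauchy_schwarz x y : l2 x -> l2 y -> Rabs (ip x y) <= nrm x * nrm y.
Proof.
  intros Hx Hy.
  assert (H : ip x y ^ 2 <= ip x x * ip y y).
  { pose proof (ip_pos _ Hx) as Px; pose proof (ip_pos _ Hy) as Py.
    pose proof (fun s => ip_quadratic _ _ s Hx Hy) as Q.
    destruct Py as [Py|Py].
    (* This [s] minimizes the quadratic polynomial. *)
    - specialize (Q (- ip x y / ip y y)).
      replace (ip x x + 2 * (- ip x y / ip y y) * ip x y
               + (- ip x y / ip y y) ^ 2 * ip y y)
        with ((ip x x * ip y y - ip x y ^ 2) / ip y y) in Q by (field; lra).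
      apply Rmult_le_compat_r with (r := ip y y) in Q; [|lra].
      unfold Rdiv in Q; rewrite Rmult_assoc, Rinv_l in Q by lra; lra.
    - rewrite <- Py in Q |- *.
      destruct (Req_dec (ip x y) 0) as [->|Hne]; [lra|].
      (* With [ip y y = 0] the polynomial is affine in [s]; this [s] gives it the value -1. *)
      specialize (Q (- (ip x x + 1) / (2 * ip x y))).
      replace (ip x x + 2 * (- (ip x x + 1) / (2 * ip x y)) * ip x y
               + (- (ip x x + 1) / (2 * ip x y)) ^ 2 * 0) with (-1) in Q by (field; trivial).
      lra. }
  rewrite !nrm_sqrt, <- sqrt_mult by now apply ip_pos.
  rewrite <- sqrt_Rsqr_abs; apply sqrt_le_1_alt; unfold Rsqr; lra.
Qed.

Lemma nrm_add x y : l2 x -> l2 y -> nrm (sadd x y) <= nrm x + nrm y.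
Proof.
  intros Hx Hy.
  pose proof (nrm_pos x); pose proof (nrm_pos y).
  pose proof (cauchy_schwarz _ _ Hx Hy) as CS; apply Rabs_le_between in CS.
  apply Rsqr_incr_0_var; [|lra].
  unfold Rsqr; replace (nrm (sadd x y) * nrm (sadd x y)) with (nrm (sadd x y) ^ 2) by ring.
  rewrite nrm_sq by now apply l2_add.
  rewrite ip_add_l, !ip_add_r, (ip_comm y x), <- !nrm_sq by auto using l2_add.
  nra.
Qed.

Lemma nrm_scal c x : nrm (sscal c x) = Rabs c * nrm x.
Proof.
  rewrite !nrm_sqrt, ip_scal_l, ip_scal_r, <- Rmult_assoc.
  rewrite sqrt_mult_alt by apply Rle_0_sqr.
  f_equal; apply sqrt_Rsqr_abs.
Qed.

Lemma entry_le_nrm x j : l2 x -> Rabs (x j) <= nrm x.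
Proof.
  intro H; rewrite nrm_sqrt, <- sqrt_Rsqr_abs; apply sqrt_le_1_alt.
  apply (sumZ_term_le (smul x x)); [intro; apply Rle_0_sqr | now apply l2_summable].
Qed.

Lemma nrm_le_sq x B : 0 <= B -> l2 x -> ip x x <= B ^ 2 -> nrm x <= B.
Proof.
  intros HB H Hle; rewrite nrm_sqrt, <- (sqrt_pow2 B) by trivial.
  now apply sqrt_le_1_alt.
Qed.

(** Every entry of [x] is bounded by its norm, so one factor can be taken out of the sum. This is
    what makes [l^2] an algebra under the pointwise product. *)
Lemma smul_sq_le x y j : l2 x -> smul (smul x y) (smul x y) j <= sscal (nrm x ^ 2) (smul y y) j.
Proof.
  intro Hx; unfold smul, sscal.
  pose proof (entry_le_nrm _ j Hx) as Hj.
  assert (x j * x j <= nrm x ^ 2).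
  { replace (x j * x j) with (Rabs (x j) ^ 2) by (rewrite pow2_abs; ring).
    apply pow_incr; split; [apply Rabs_pos | trivial]. }
  pose proof (Rle_0_sqr (y j)); unfold Rsqr in *; nra.
Qed.

Lemma l2_mul x y : l2 x -> l2 y -> l2 (smul x y).
Proof.
  intros Hx Hy; apply l2_summable.
  apply summable_le with (g := sscal (nrm x ^ 2) (smul y y)).
  - intro j; rewrite Rabs_pos_eq by apply Rle_0_sqr; now apply smul_sq_le.
  - now apply summable_scal, l2_summable.
Qed.

Lemma nrm_mul x y : l2 x -> l2 y -> nrm (smul x y) <= nrm x * nrm y.
Proof.
  intros Hx Hy; apply nrm_le_sq; [apply Rmult_le_pos; apply nrm_pos | now apply l2_mul|].
  rewrite Rpow_mult_distr, (nrm_sq y) by trivial.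
  unfold ip; rewrite <- sumZ_scal; apply sumZ_le.
  - intro j; now apply smul_sq_le.
  - now apply l2_summable, l2_mul.
  - now apply summable_scal, l2_summable.
Qed.

Definition lap (x : Z -> R) : Z -> R := sadd (translate 1 x) (translate (-1) x).

Lemma l2_shift1 x : l2 x -> l2 (translate 1 x).
Proof. rewrite !l2_summable; apply (summable_shift1 (smul x x)). Qed.

Lemma l2_shift_1 x : l2 x -> l2 (translate (-1) x).
Proof. rewrite !l2_summable; apply (summable_shift_1 (smul x x)). Qed.

Lemma nrm_shift1 x : l2 x -> nrm (translate 1 x) = nrm x.
Proof.
  intro H; rewrite !nrm_sqrt; f_equal.
  now apply (sumZ_shift1 (smul x x)), l2_summable.
Qed.

Lemma nrm_shift_1 x : l2 x -> nrm (translate (-1) x) = nrm x.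
Proof.
  intro H; rewrite !nrm_sqrt; f_equal.
  now apply (sumZ_shift_1 (smul x x)), l2_summable.
Qed.

Lemma l2_lap x : l2 x -> l2 (lap x).
Proof. intro H; apply l2_add; [apply l2_shift1 | apply l2_shift_1]; trivial. Qed.

Lemma nrm_lap x : l2 x -> nrm (lap x) <= 2 * nrm x.
Proof.
  intro H; eapply Rle_trans; [apply nrm_add; [apply l2_shift1 | apply l2_shift_1]; trivial|].
  rewrite nrm_shift1, nrm_shift_1 by trivial; lra.
Qed.

(** The two unit translations are adjoint to each other, by translation invariance of the sum. *)
Lemma ip_lap x y : l2 x -> l2 y -> ip (lap x) y = ip x (lap y).
Proof.
  intros Hx Hy.
  assert (E1 : ip (translate 1 x) y = ip x (translate (-1) y)).
  { unfold ip; rewrite <- (sumZ_shift_1 (smul (translate 1 x) y))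
      by auto using l2_mul_summable, l2_shift1.
    f_equal; apply functional_extensionality; intro j; unfold smul, translate.
    do 2 f_equal; lia. }
  assert (E2 : ip (translate (-1) x) y = ip x (translate 1 y)).
  { unfold ip; rewrite <- (sumZ_shift1 (smul (translate (-1) x) y))
      by auto using l2_mul_summable, l2_shift_1.
    f_equal; apply functional_extensionality; intro j; unfold smul, translate.
    do 2 f_equal; lia. }
  unfold lap; rewrite ip_add_l, ip_add_r, E1, E2 by auto using l2_shift1, l2_shift_1.
  ring.
Qed.

Lemma lap_add x y : lap (sadd x y) = sadd (lap x) (lap y).
Proof. apply functional_extensionality; intro; unfold lap, sadd, translate; ring. Qed.

Lemma lap_scal c x : lap (sscal c x) = sscal c (lap x).
Proof. apply functional_extensionality; intro; unfold lap, sadd, sscal, translate; ring. Qed.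
(** * Differentiation of l2(Z)-valued functions *)

Definition rem (x : R -> Z -> R) (t : R) (v : Z -> R) (h : R) : Z -> R :=
  sadd (x (t + h)) (sscal (-1) (sadd (x t) (sscal h v))).

(** The Frechet form of the derivative: without division by [h], the value [h = 0] needs no
    exception, and remainders of sums and products combine by the triangle inequality. *)
Definition dl2 (x : R -> Z -> R) (t : R) (v : Z -> R) : Prop :=
  l2 (x t) /\ l2 v /\
  forall e, 0 < e -> locally 0 (fun h => l2 (x (t + h)) /\ nrm (rem x t v h) <= e * Rabs h).

Lemma l2_rem x t v h : l2 (x t) -> l2 v -> l2 (x (t + h)) -> l2 (rem x t v h).
Proof. intros; unfold rem; auto using l2_add, l2_scal. Qed.

Lemma locally_0_translate (P : R -> Prop) t : locally t P -> locally 0 (fun h => P (t + h)).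
Proof.
  intros [d H]; exists d; intros h Hh; apply H.
  unfold ball in *; simpl in *; unfold AbsRing_ball, abs, minus, plus, opp in *; simpl in *.
  replace (t + h + - t) with (h + - 0) by ring; trivial.
Qed.

Lemma locally_0_lt d : 0 < d -> locally 0 (fun h => Rabs h < d).
Proof.
  intro Hd; exists (mkposreal d Hd); intros h Hh.
  unfold ball in Hh; simpl in Hh; unfold AbsRing_ball, abs, minus, plus, opp in Hh; simpl in Hh.
  now rewrite Ropp_0, Rplus_0_r in Hh.
Qed.

Lemma locally_0_scal (P : R -> Prop) c : locally 0 P -> locally 0 (fun h => P (c * h)).
Proof.
  intros [d H].
  assert (Hc : 0 < d / (Rabs c + 1)).
  { apply Rdiv_lt_0_compat; [apply cond_pos | generalize (Rabs_pos c); lra]. }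
  generalize (locally_0_lt _ Hc); apply filter_imp; intros h Hh; apply H.
  unfold ball; simpl; unfold AbsRing_ball, abs, minus, plus, opp; simpl.
  rewrite Ropp_0, Rplus_0_r, Rabs_mult.
  pose proof (Rabs_pos c); pose proof (Rabs_pos h).
  apply Rmult_lt_compat_r with (r := Rabs c + 1) in Hh; [|lra].
  unfold Rdiv in Hh; rewrite Rmult_assoc, Rinv_l in Hh by lra; nra.
Qed.

Lemma is_derive_frechet (f : R -> R) t l :
  (forall e, 0 < e -> locally 0 (fun h => Rabs (f (t + h) - f t - h * l) <= e * Rabs h))
  <-> is_derive f t l.
Proof.
  split.
  - intro H; split; [apply is_linear_scal_l|].
    intros x Hx; apply (is_filter_lim_locally_unique (V := R_NormedModule)) in Hx; subst x; intro e.
    destruct (H e (cond_pos e)) as [d Hd]; exists d; refine (fun (y : R) Hy => _).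
    specialize (Hd (y - t)).
    replace (t + (y - t)) with y in Hd by ring.
    unfold norm, minus, plus, opp, scal; simpl; unfold abs, mult; simpl.
    replace (f y + - f t + - ((y + - t) * l)) with (f y - f t - (y - t) * l) by ring.
    apply Hd; unfold ball in *; simpl in *;
      unfold AbsRing_ball, abs, minus, plus, opp in *; simpl in *.
    now replace (y - t + - 0) with (y + - t) by ring.
  - intros [_ H] e He.
    specialize (H t (fun P HP => HP) (mkposreal e He)).
    apply locally_0_translate in H; revert H; apply filter_imp; refine (fun h : R => _).
    unfold norm, minus, plus, opp, scal; simpl; unfold abs, mult; simpl.
    replace (f (t + h) + - f t + - ((t + h + - t) * l))
      with (f (t + h) - f t - h * l) by ring.
    now replace (t + h + - t) with h by ring.
Qed.

Section Contraction.
Context {V : NormedModule R_AbsRing} (phi : V -> R).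
Hypothesis phi_minus : forall a b, phi (minus a b) = phi a - phi b.
Hypothesis phi_scal : forall (r : R) a, phi (scal r a) = r * phi a.
Hypothesis phi_le : forall a, Rabs (phi a) <= norm a.

Lemma ell2_minus (x y : Z -> V) : ell2 x -> ell2 y -> ell2 (fun j => minus (x j) (y j)).
Proof.
  intros Hx Hy.
  apply (ex_series_le (V := R_CompleteNormedModule)) with
    (b := fun n => 2 * (ell2_term x n + ell2_term y n)).
  - assert (Hab : forall a b : V, norm (minus a b) ^ 2 <= 2 * (norm a ^ 2 + norm b ^ 2)).
    { intros a b; pose proof (norm_triangle a (opp b)) as H; rewrite norm_opp in H.
      apply Rle_trans with ((norm a + norm b) ^ 2).
      - apply pow_incr; split; [apply norm_ge_0 | exact H].
      - pose proof (pow2_ge_0 (norm a - norm b)); lra. }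
    intro n; unfold norm at 1; simpl; unfold abs; simpl.
    rewrite Rabs_pos_eq by (apply Rplus_le_le_0_compat; apply pow2_ge_0).
    unfold ell2_term.
    pose proof (Hab (x (Z.of_nat n)) (y (Z.of_nat n))).
    pose proof (Hab (x (- Z.of_nat n - 1)%Z) (y (- Z.of_nat n - 1)%Z)); lra.
  - apply (ex_series_scal 2 (fun n => ell2_term x n + ell2_term y n)).
    apply (ex_series_plus _ _ Hx Hy).
Qed.

Lemma ell2_scal (r : R) (x : Z -> V) : ell2 x -> ell2 (fun j => scal r (x j)).
Proof.
  intros Hx.
  apply (ex_series_le (V := R_CompleteNormedModule)) with
    (b := fun n => Rabs r ^ 2 * ell2_term x n);
    [|apply (ex_series_scal (Rabs r ^ 2) _ Hx)].
  assert (Ha : forall a : V, norm (scal r a) ^ 2 <= Rabs r ^ 2 * norm a ^ 2).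
  { intro a; rewrite <- Rpow_mult_distr; apply pow_incr; split; [apply norm_ge_0|].
    apply (norm_scal r a). }
  intro n; unfold norm at 1; simpl; unfold abs; simpl.
  rewrite Rabs_pos_eq by (apply Rplus_le_le_0_compat; apply pow2_ge_0).
  unfold ell2_term.
  pose proof (Ha (x (Z.of_nat n))); pose proof (Ha (x (- Z.of_nat n - 1)%Z)); simpl in *; lra.
Qed.

Lemma ell2_contract (x : Z -> V) : ell2 x ->
  l2 (fun j => phi (x j)) /\ nrm (fun j => phi (x j)) <= ell2_norm x.
Proof.
  intro Hx.
  assert (Hp : forall a : V, 0 <= norm (V := R_NormedModule) (phi a) ^ 2 <= norm a ^ 2).
  { intro a; split; [apply pow2_ge_0|].
    apply pow_incr; split; [apply norm_ge_0 | apply phi_le]. }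
  assert (Hn : forall n, 0 <= ell2_term (V := R_NormedModule) (fun j => phi (x j)) n
                         <= ell2_term x n).
  { intro n; unfold ell2_term.
    pose proof (Hp (x (Z.of_nat n))); pose proof (Hp (x (- Z.of_nat n - 1)%Z)); lra. }
  split.
  - apply (ex_series_le (V := R_CompleteNormedModule)) with (2 := Hx); intro n.
    unfold norm at 1; simpl; unfold abs; simpl; rewrite Rabs_pos_eq; apply Hn.
  - apply sqrt_le_1_alt, Series_le; trivial.
Qed.

(** [phi] stands for the identity of the reals, [Re] or [Im]. Applied entrywise, a linear map that
    does not increase norms commutes with difference quotients and can only shrink their distance to
    the derivative. *)
Lemma dl2_contract (x : R -> Z -> V) t v :
  is_ell2_derive x t v -> dl2 (fun s j => phi (x s j)) t (fun j => phi (v j)).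
Proof.
  intros (Hx & Hv & Hlim).
  assert (Hxt : ell2 (x t)) by exact (locally_singleton _ _ Hx).
  split; [|split]; [now apply ell2_contract | now apply ell2_contract |].
  intros e He.
  apply is_lim_spec in Hlim; specialize (Hlim (mkposreal e He)); simpl in Hlim.
  unfold locally', within in Hlim.
  generalize (filter_and _ _ Hlim (locally_0_translate _ _ Hx)); apply filter_imp.
  intros h [Hh Hl].
  split; [apply (ell2_contract (x (t + h))); trivial|].
  destruct (Req_dec h 0) as [->|Hne].
  - rewrite Rabs_R0, Rmult_0_r.
    replace (rem _ _ _ _) with (sscal 0 (fun j => phi (x t j))).
    + rewrite nrm_scal, Rabs_R0; lra.
    + apply functional_extensionality; intro j; unfold rem, sadd, sscal.
      rewrite Rplus_0_r; ring.
  - specialize (Hh Hne); rewrite Rminus_0_r in Hh.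
    set (q := fun j => minus (scal (/ h) (minus (x (t + h) j) (x t j))) (v j)) in Hh.
    assert (Hq : ell2 q) by (apply ell2_minus; trivial; now apply ell2_scal, ell2_minus).
    replace (rem _ _ _ _) with (sscal h (fun j => phi (q j))).
    + rewrite nrm_scal, Rmult_comm; apply Rmult_le_compat_r; [apply Rabs_pos|].
      apply Rle_trans with (ell2_norm q); [now apply ell2_contract|].
      apply Rabs_lt_between in Hh; lra.
    + apply functional_extensionality; intro j; unfold rem, sadd, sscal, q.
      rewrite phi_minus, phi_scal, phi_minus; field; trivial.
Qed.
End Contraction.

Lemma dl2_of_real (x : R -> Z -> R) t v :
  is_ell2_derive (V := R_NormedModule) x t v -> dl2 x t v.
Proof.
  apply (dl2_contract (V := R_NormedModule) (fun a => a)); intros; trivial.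
  apply Rle_refl.
Qed.

Lemma dl2_ext (x y : R -> Z -> R) t v w :
  (forall s, x s = y s) -> v = w -> dl2 x t v -> dl2 y t w.
Proof.
  intros Hxy -> H; replace y with x; trivial; now apply functional_extensionality.
Qed.

Lemma dl2_add x y t v w :
  dl2 x t v -> dl2 y t w -> dl2 (fun s => sadd (x s) (y s)) t (sadd v w).
Proof.
  intros (Hx & Hv & Dx) (Hy & Hw & Dy); split; [|split]; auto using l2_add.
  intros e He; assert (He2 : 0 < e / 2) by lra.
  generalize (filter_and _ _ (Dx _ He2) (Dy _ He2)); apply filter_imp.
  intros h [[Lx Nx] [Ly Ny]]; split; auto using l2_add.
  replace (rem _ _ _ _) with (sadd (rem x t v h) (rem y t w h)).
  - eapply Rle_trans; [apply nrm_add; auto using l2_rem | lra].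
  - unfold rem; seq_ring.
Qed.

Lemma dl2_scal c x t v : dl2 x t v -> dl2 (fun s => sscal c (x s)) t (sscal c v).
Proof.
  intros (Hx & Hv & Dx); split; [|split]; auto using l2_scal.
  intros e He; pose proof (Rabs_pos c).
  assert (He2 : 0 < e / (Rabs c + 1)) by (apply Rdiv_lt_0_compat; lra).
  generalize (Dx _ He2); apply filter_imp.
  intros h [Lx Nx]; split; auto using l2_scal.
  replace (rem _ _ _ _) with (sscal c (rem x t v h)) by (unfold rem; seq_ring).
  rewrite nrm_scal.
  replace (e * Rabs h) with ((Rabs c + 1) * (e / (Rabs c + 1) * Rabs h)) by (field; lra).
  pose proof (nrm_pos (rem x t v h)); nra.
Qed.

Lemma dl2_lap x t v : dl2 x t v -> dl2 (fun s => lap (x s)) t (lap v).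
Proof.
  intros (Hx & Hv & Dx); split; [|split]; auto using l2_lap.
  intros e He; assert (He2 : 0 < e / 2) by lra.
  generalize (Dx _ He2); apply filter_imp.
  intros h [Lx Nx]; split; auto using l2_lap.
  replace (rem _ _ _ _) with (lap (rem x t v h))
    by (unfold rem; rewrite !lap_add, !lap_scal, !lap_add, !lap_scal; reflexivity).
  pose proof (nrm_lap _ (l2_rem _ _ _ _ Hx Hv Lx)); lra.
Qed.

Lemma dl2_dilate c x t v :
  dl2 x (c * t) v -> dl2 (fun s => x (c * s)) t (sscal c v).
Proof.
  intros (Hx & Hv & Dx); split; [|split]; auto using l2_scal.
  intros e He; pose proof (Rabs_pos c).
  assert (He2 : 0 < e / (Rabs c + 1)) by (apply Rdiv_lt_0_compat; lra).
  generalize (locally_0_scal _ c (Dx _ He2)); apply filter_imp.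
  intros h [Lx Nx]; rewrite <- Rmult_plus_distr_l in Lx; split; trivial.
  replace (rem _ _ _ _) with (rem x (c * t) v (c * h)).
  - apply Rle_trans with (1 := Nx); rewrite Rabs_mult.
    replace (e * Rabs h) with (e / (Rabs c + 1) * ((Rabs c + 1) * Rabs h)) by (field; lra).
    apply Rmult_le_compat_l; [lra|]; pose proof (Rabs_pos h); nra.
  - unfold rem; rewrite <- Rmult_plus_distr_l; seq_ring.
Qed.

Lemma dl2_entry x t v j : dl2 x t v -> is_derive (fun s => x s j) t (v j).
Proof.
  intros (Hx & Hv & Dx); apply is_derive_frechet; intros e He.
  generalize (Dx e He); apply filter_imp; intros h [Lx Nx].
  apply Rle_trans with (2 := Nx).
  replace (_ - _ - _) with (rem x t v h j) by (unfold rem, sadd, sscal; ring).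
  apply entry_le_nrm; auto using l2_rem.
Qed.

(* Remainder estimate common to every bilinear product rule, from
   [B(x+,y+) - B(x,y) - h (B(x',y) + B(x,y')) = B(r1,y+) + B(x,r2) + h B(x',y+ - y)]. *)
Lemma product_remainder (X X' Y Y' e : R) :
  0 <= X -> 0 <= X' -> 0 <= Y -> 0 <= Y' -> 0 < e ->
  exists e1, 0 < e1 /\ locally 0 (fun h => forall r1 r2 d,
    r1 <= e1 * Rabs h -> r2 <= e1 * Rabs h -> 0 <= d -> d <= (Y' + 1) * Rabs h ->
    r1 * (Y + d) + X * r2 + Rabs h * (X' * d) <= e * Rabs h).
Proof.
  intros HX HX' HY HY' He.
  (* Half of [e] pays for the terms in [r1] and [r2], through [e1 = e / D]; the other half pays for
     the term quadratic in [h], through [|h| < e / D']. The condition [|h| < 1] bounds [d] by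
     [Y' + 1]. *)
  pose (D := 2 * (X + Y + Y' + 1)); assert (HD : 0 < D) by (unfold D; lra).
  pose (D' := 2 * (X' * (Y' + 1) + 1)); assert (HD' : 0 < D') by (unfold D'; nra).
  assert (E1 : e / D * (X + Y + Y' + 1) = e / 2) by (unfold D; field; lra).
  assert (P1 : 0 < e / D) by now apply Rdiv_lt_0_compat.
  assert (P2 : 0 < e / D') by now apply Rdiv_lt_0_compat.
  exists (e / D); split; trivial.
  generalize (filter_and _ _ (locally_0_lt 1 Rlt_0_1) (locally_0_lt _ P2)); apply filter_imp.
  intros h [H1 H2] r1 r2 d Hr1 Hr2 Hd0 Hd; pose proof (Rabs_pos h) as Hh.
  set (k := Rabs h) in *; set (e1 := e / D) in *.
  assert (A1 : k * (X' * (Y' + 1)) <= e / 2).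
  { assert (HDk : k * D' <= e).
    { apply Rlt_le in H2.
      apply Rmult_le_compat_r with (r := D') in H2; [|lra].
      unfold Rdiv in H2; rewrite Rmult_assoc, Rinv_l in H2 by lra; lra. }
    unfold D' in HDk; nra. }
  assert (A2 : r1 * (Y + d) <= e1 * k * (Y + Y' + 1)).
  { apply Rle_trans with (e1 * k * (Y + d)); [apply Rmult_le_compat_r; lra|].
    apply Rmult_le_compat_l; nra. }
  assert (A3 : X * r2 <= X * (e1 * k)) by (apply Rmult_le_compat_l; lra).
  assert (A4 : k * (X' * d) <= k * (X' * (Y' + 1)) * k).
  { replace (k * (X' * (Y' + 1)) * k) with (k * (X' * ((Y' + 1) * k))) by ring.
    apply Rmult_le_compat_l; trivial; apply Rmult_le_compat_l; trivial. }
  assert (A5 : k * (X' * (Y' + 1)) * k <= e / 2 * k) by (apply Rmult_le_compat_r; trivial).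
  replace (e * k) with (e1 * (X + Y + Y' + 1) * k + e / 2 * k) by (rewrite E1; field).
  lra.
Qed.

Definition incr (x : R -> Z -> R) (t h : R) : Z -> R := sadd (x (t + h)) (sscal (-1) (x t)).

Lemma l2_incr x t h : l2 (x t) -> l2 (x (t + h)) -> l2 (incr x t h).
Proof. intros; unfold incr; auto using l2_add, l2_scal. Qed.

Lemma dl2_incr x t v : dl2 x t v ->
  locally 0 (fun h => nrm (incr x t h) <= (nrm v + 1) * Rabs h /\
                      nrm (x (t + h)) <= nrm (x t) + nrm (incr x t h)).
Proof.
  intros (Hx & Hv & Dx); generalize (Dx 1 Rlt_0_1); apply filter_imp.
  intros h [Lx Nx]; split.
  - replace (incr x t h) with (sadd (rem x t v h) (sscal h v)) by (unfold incr, rem; seq_ring).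
    eapply Rle_trans; [apply nrm_add; auto using l2_rem, l2_scal|].
    rewrite nrm_scal; lra.
  - replace (x (t + h)) with (sadd (x t) (incr x t h)) at 1 by (unfold incr; seq_ring).
    apply nrm_add; auto using l2_incr.
Qed.

Lemma dl2_mul x y t v w : dl2 x t v -> dl2 y t w ->
  dl2 (fun s => smul (x s) (y s)) t (sadd (smul v (y t)) (smul (x t) w)).
Proof.
  intros Hdx Hdy; pose proof Hdx as (Hx & Hv & Dx); pose proof Hdy as (Hy & Hw & Dy).
  split; [|split]; auto using l2_add, l2_mul.
  intros e He.
  destruct (product_remainder (nrm (x t)) (nrm v) (nrm (y t)) (nrm w) e)
    as (e1 & He1 & Hrem); trivial; try apply nrm_pos.
  generalize (filter_and _ _ Hrem (filter_and _ _ (dl2_incr _ _ _ Hdy)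
                (filter_and _ _ (Dx _ He1) (Dy _ He1)))); apply filter_imp.
  intros h (Hh & [Ny Ny'] & [Lx Rx] & [Ly Ry]); split; auto using l2_mul.
  replace (rem _ _ _ _) with
    (sadd (sadd (smul (rem x t v h) (y (t + h))) (smul (x t) (rem y t w h)))
          (sscal h (smul v (incr y t h)))) by (unfold rem, incr; seq_ring).
  assert (Lr : l2 (rem x t v h)) by auto using l2_rem.
  assert (Lr' : l2 (rem y t w h)) by auto using l2_rem.
  assert (Li : l2 (incr y t h)) by auto using l2_incr.
  apply Rle_trans with (2 := Hh _ _ _ Rx Ry (nrm_pos (incr y t h)) Ny).
  eapply Rle_trans; [apply nrm_add; auto using l2_add, l2_mul, l2_scal|].
  apply Rplus_le_compat.
  - eapply Rle_trans; [apply nrm_add; auto using l2_mul|].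
    apply Rplus_le_compat; [|apply nrm_mul; trivial].
    eapply Rle_trans; [apply nrm_mul; trivial|].
    apply Rmult_le_compat_l; [apply nrm_pos | trivial].
  - rewrite nrm_scal; apply Rmult_le_compat_l; [apply Rabs_pos | apply nrm_mul; trivial].
Qed.

Lemma dl2_scal_fun (g : R -> R) g' x t v : is_derive g t g' -> dl2 x t v ->
  dl2 (fun s => sscal (g s) (x s)) t (sadd (sscal g' (x t)) (sscal (g t) v)).
Proof.
  intros Dg Hdx; pose proof Hdx as (Hx & Hv & Dx).
  split; [|split]; auto using l2_add, l2_scal.
  intros e He.
  destruct (product_remainder (Rabs (g t)) (Rabs g') (nrm (x t)) (nrm v) e)
    as (e1 & He1 & Hrem); trivial; try apply nrm_pos; try apply Rabs_pos.
  rewrite <- is_derive_frechet in Dg.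
  generalize (filter_and _ _ Hrem (filter_and _ _ (dl2_incr _ _ _ Hdx)
                (filter_and _ _ (Dg _ He1) (Dx _ He1)))); apply filter_imp.
  intros h (Hh & [Nx Nx'] & Rg & [Lx Rx]); split; auto using l2_scal.
  replace (rem _ _ _ _) with
    (sadd (sadd (sscal (g (t + h) - g t - h * g') (x (t + h))) (sscal (g t) (rem x t v h)))
          (sscal h (sscal g' (incr x t h)))) by (unfold rem, incr; seq_ring).
  assert (Lr : l2 (rem x t v h)) by auto using l2_rem.
  assert (Li : l2 (incr x t h)) by auto using l2_incr.
  apply Rle_trans with (2 := Hh _ _ _ Rg Rx (nrm_pos (incr x t h)) Nx).
  eapply Rle_trans; [apply nrm_add; auto using l2_add, l2_scal|].
  rewrite !nrm_scal; apply Rplus_le_compat_r.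
  eapply Rle_trans; [apply nrm_add; auto using l2_scal|].
  rewrite !nrm_scal; apply Rplus_le_compat_r.
  apply Rmult_le_compat_l; [apply Rabs_pos | trivial].
Qed.

Lemma is_derive_ip x y t v w : dl2 x t v -> dl2 y t w ->
  is_derive (fun s => ip (x s) (y s)) t (ip v (y t) + ip (x t) w).
Proof.
  intros Hdx Hdy; pose proof Hdx as (Hx & Hv & Dx); pose proof Hdy as (Hy & Hw & Dy).
  apply is_derive_frechet; intros e He.
  destruct (product_remainder (nrm (x t)) (nrm v) (nrm (y t)) (nrm w) e)
    as (e1 & He1 & Hrem); trivial; try apply nrm_pos.
  generalize (filter_and _ _ Hrem (filter_and _ _ (dl2_incr _ _ _ Hdy)
                (filter_and _ _ (Dx _ He1) (Dy _ He1)))); apply filter_imp.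
  intros h (Hh & [Ny Ny'] & [Lx Rx] & [Ly Ry]).
  assert (Lr : l2 (rem x t v h)) by auto using l2_rem.
  assert (Lr' : l2 (rem y t w h)) by auto using l2_rem.
  assert (Li : l2 (incr y t h)) by auto using l2_incr.
  replace (_ - _ - _) with
    (ip (rem x t v h) (y (t + h)) + ip (x t) (rem y t w h) + h * ip v (incr y t h)).
  - apply Rle_trans with (2 := Hh _ _ _ Rx Ry (nrm_pos (incr y t h)) Ny).
    eapply Rle_trans; [apply Rabs_triang|]; apply Rplus_le_compat.
    + eapply Rle_trans; [apply Rabs_triang|].
      apply Rplus_le_compat; [|apply cauchy_schwarz; trivial].
      eapply Rle_trans; [apply cauchy_schwarz; trivial|].
      apply Rmult_le_compat_l; [apply nrm_pos | trivial].
    + rewrite Rabs_mult; apply Rmult_le_compat_l; [apply Rabs_pos|].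
      apply cauchy_schwarz; trivial.
  - unfold rem, incr.
    repeat first [ rewrite ip_add_l by auto using l2_add, l2_scal
                 | rewrite ip_add_r by auto using l2_add, l2_scal
                 | rewrite ip_scal_l | rewrite ip_scal_r ].
    ring.
Qed.
(** * Residual of the leading-order approximation *)

(** The index carries all parameters and sequences at once, so that [K] is chosen before any of them
    and can be assembled along the syntax of a polynomial expression. *)
Definition uniformly_bounded {I : Type} (D : I -> Prop) (F : I -> Z -> R) : Prop :=
  exists K, 0 <= K /\ forall i, D i -> l2 (F i) /\ nrm (F i) <= K.

Lemma bounded_add {I} (D : I -> Prop) F G :
  uniformly_bounded D F -> uniformly_bounded D G ->
  uniformly_bounded D (fun i => sadd (F i) (G i)).
Proof.
  intros (K & HK & HF) (L & HL & HG); exists (K + L); split; [lra|].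
  intros i Hi; destruct (HF i Hi), (HG i Hi); split; auto using l2_add.
  eapply Rle_trans; [apply nrm_add; trivial | lra].
Qed.

Lemma bounded_mul {I} (D : I -> Prop) F G :
  uniformly_bounded D F -> uniformly_bounded D G ->
  uniformly_bounded D (fun i => smul (F i) (G i)).
Proof.
  intros (K & HK & HF) (L & HL & HG); exists (K * L); split; [nra|].
  intros i Hi; destruct (HF i Hi), (HG i Hi); split; auto using l2_mul.
  eapply Rle_trans; [apply nrm_mul; trivial|].
  apply Rmult_le_compat; trivial; apply nrm_pos.
Qed.

Lemma bounded_lap {I} (D : I -> Prop) F :
  uniformly_bounded D F -> uniformly_bounded D (fun i => lap (F i)).
Proof.
  intros (K & HK & HF); exists (2 * K); split; [lra|].
  intros i Hi; destruct (HF i Hi); split; auto using l2_lap.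
  eapply Rle_trans; [apply nrm_lap; trivial | lra].
Qed.

Lemma bounded_scal {I} (D : I -> Prop) (c : I -> R) k F :
  (forall i, D i -> Rabs (c i) <= k) ->
  uniformly_bounded D F -> uniformly_bounded D (fun i => sscal (c i) (F i)).
Proof.
  (* [k] itself may be negative when [D] is empty. *)
  intros Hc (K & HK & HF); exists (Rabs k * K).
  split; [apply Rmult_le_pos; trivial; apply Rabs_pos|].
  intros i Hi; destruct (HF i Hi); split; auto using l2_scal.
  rewrite nrm_scal; apply Rmult_le_compat; trivial; [apply Rabs_pos | apply nrm_pos|].
  apply Rle_trans with (1 := Hc i Hi), Rle_abs.
Qed.

Definition cubic (u v : Z -> R) : Z -> R := smul (sadd (smul u u) (smul v v)) u.

Definition gterm (del : R) (u v : Z -> R) : Z -> R :=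
  sadd (sscal (/ 4) (lap (lap u))) (sscal (-3 * del) (cubic u v)).

(** With this operator [H], acting on each component of [a], the gdNLS equation reads
    [a' = - i H(a)]. The second argument enters only through the weight [|a|^2] of the cubic
    term. *)
Definition hterm (eps del : R) (u v : Z -> R) : Z -> R :=
  sscal (/ 2) (sadd (lap u) (sscal eps (gterm del u v))).

(* The gdNLS equation for [z_j(t) = a_j(eps t) e^{it} = u_j + i v_j]; the factor
   [e^{it}] drops out by gauge invariance, which makes the system autonomous. *)
Definition rotating_flow (eps del : R) (u v : R -> Z -> R) : Prop :=
  forall t,
    dl2 u t (sadd (sscal (-1) (v t)) (sscal eps (hterm eps del (v t) (u t)))) /\
    dl2 v t (sadd (u t) (sscal (- eps) (hterm eps del (u t) (v t)))).

(* [Re z^3]; correspondingly [Im z^3 = - re_cube v u]. *)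
Definition re_cube (u v : Z -> R) : Z -> R :=
  smul u (sadd (smul u u) (sscal (-3) (smul v v))).

Definition approx (eps del : R) (u v : Z -> R) : Z -> R :=
  sadd (sscal 2 u) (sscal (del * eps ^ 2 / 4) (re_cube u v)).

(* The time derivative of [approx] without its terms of order [rho * eps]. *)
Definition approx_vel (eps del : R) (u v : Z -> R) : Z -> R :=
  sadd (sadd (sscal (-2) v) (sscal (2 * eps) (hterm eps del v u)))
       (sscal (3 * del * eps ^ 2 / 4) (re_cube v u)).

(** The contribution of the [eps] part of the flow to the derivative of the third harmonic; its
    prefactor is [rho * eps = del * eps^3]. *)
Definition residual1 (eps del : R) (u v : Z -> R) : Z -> R :=
  sscal (del / 4)
    (sadd (sscal 3 (smul (sadd (smul u u) (sscal (-1) (smul v v))) (hterm eps del v u)))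
          (sscal 6 (smul (smul u v) (hterm eps del u v)))).

(** In order: the [eps] part of the flow acting on [gterm], in its linear and its cubic piece; the
    [gterm] inside [lap H]; the [eps] part of the flow acting on the third harmonic; the coupling of
    the third harmonic; and [X^3 - (2u)^3] in factored form. *)
Definition residual2 (eps del : R) (u v : Z -> R) : Z -> R :=
  let H := hterm eps del u v in
  let G := hterm eps del v u in
  let X := approx eps del u v in
  sadd (sadd (sscal (- / 4) (lap (lap H)))
       (sscal (-3 * del)
          (sadd (sscal 2 (smul (smul u v) G))
                (sscal (-1) (smul (sadd (smul u u) (sscal 3 (smul v v))) H)))))
  (sadd (sscal (- / 2) (lap (gterm del u v)))
  (sadd (sscal (- 3 * del / 4)
          (sadd (sscal 6 (smul (smul u v) G))
                (sscal (-3) (smul (sadd (smul u u) (sscal (-1) (smul v v))) H))))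
  (sadd (sscal (- del / 4) (lap (re_cube u v)))
        (sscal (eps * del ^ 2 / 4)
          (smul (re_cube u v)
             (sadd (smul X X) (sadd (sscal 2 (smul u X)) (sscal 4 (smul u u))))))))).

Ltac dl2_tac :=
  lazymatch goal with
  | |- dl2 (fun s => sadd _ _) _ _ => apply dl2_add; dl2_tac
  | |- dl2 (fun s => smul _ _) _ _ => apply dl2_mul; dl2_tac
  | |- dl2 (fun s => sscal _ _) _ _ => apply dl2_scal; dl2_tac
  | |- dl2 (fun s => lap _) _ _ => apply dl2_lap; dl2_tac
  | |- _ => eassumption
  end.

Lemma dl2_approx eps del u v t : rotating_flow eps del u v ->
  dl2 (fun s => approx eps del (u s) (v s)) t
      (sadd (approx_vel eps del (u t) (v t)) (sscal (eps ^ 3) (residual1 eps del (u t) (v t)))).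
Proof.
  intro F; destruct (F t) as [Du Dv].
  eapply dl2_ext; [intro; reflexivity| |unfold approx, re_cube; dl2_tac].
  unfold approx_vel, residual1, re_cube.
  apply functional_extensionality; intro; unfold sadd, smul, sscal; field.
Qed.

(** The ansatz is tuned to cancel everything below order [eps^3]. At order [eps^2] the flow produces
    [2 gterm - lap (lap u) / 2]; the coefficient 1/4 in [gterm] removes the double coupling and
    leaves [-6 del |z|^2 u]. This is the resonant part of [- del (2u)^3], since
    [(2u)^3 = 6 |z|^2 u + 2 Re z^3]. The other part comes from the correction [(rho/4) Re z^3],
    which oscillates at frequency 3 and so contributes [(1 - 9) / 4 = -2]. *)
Lemma dl2_approx_vel eps del u v t : rotating_flow eps del u v ->
  let X := approx eps del (u t) (v t) in
  dl2 (fun s => approx_vel eps del (u s) (v s)) t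
      (sadd (sadd (sscal (-1) X) (sscal eps (lap X)))
            (sadd (sscal (- (del * eps ^ 2)) (smul X (smul X X)))
                  (sscal (eps ^ 3) (residual2 eps del (u t) (v t))))).
Proof.
  intros F X; destruct (F t) as [Du Dv].
  eapply dl2_ext; [intro; reflexivity| |].
  2: { unfold approx_vel, re_cube, hterm at 1, gterm, cubic; dl2_tac. }
  unfold X, approx_vel, residual2, approx, re_cube, hterm, gterm, cubic.
  (* Each pass pushes [lap] one level deeper, until it acts only on products and single sequences;
     those values are atoms for [field]. *)
  rewrite ?lap_add, ?lap_scal, ?lap_add, ?lap_scal, ?lap_add, ?lap_scal,
    ?lap_add, ?lap_scal, ?lap_add, ?lap_scal.
  apply functional_extensionality; intro; unfold sadd, smul, sscal; field.
Qed.

(** * Bounds on the residuals, uniform in the parameters *)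

Record nls_state := { p_eps : R; p_del : R; p_u : Z -> R; p_v : Z -> R }.

Definition admissible (M : R) (p : nls_state) : Prop :=
  (0 <= p_eps p <= 1 /\ 0 <= p_del p <= 1) /\
  (l2 (p_u p) /\ nrm (p_u p) <= M) /\ (l2 (p_v p) /\ nrm (p_v p) <= M).

Lemma admissible_coef M p : admissible M p ->
  0 <= p_eps p <= 1 /\ 0 <= p_del p <= 1 /\
  0 <= p_del p * p_eps p ^ 2 <= 1 /\ 0 <= p_eps p * p_del p ^ 2 <= 1.
Proof.
  intros [[H1 H2] _]; repeat split; try apply H1; try apply H2; simpl;
    try (repeat apply Rmult_le_pos; lra).
  all: rewrite <- (Rmult_1_l 1); apply Rmult_le_compat; try lra;
    try (repeat apply Rmult_le_pos; lra); nra.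
Qed.

(* Every coefficient occurring in the residuals has absolute value at most 6. *)
Ltac bounded_tac :=
  lazymatch goal with
  | |- uniformly_bounded _ (fun p => sadd _ _) => apply bounded_add; bounded_tac
  | |- uniformly_bounded _ (fun p => smul _ _) => apply bounded_mul; bounded_tac
  | |- uniformly_bounded _ (fun p => lap _) => apply bounded_lap; bounded_tac
  | |- uniformly_bounded _ (fun p => sscal _ _) =>
      apply (bounded_scal _ _ 6);
      [ let p := fresh in let H := fresh in
        intros p H; apply admissible_coef in H; apply Rabs_le; lra
      | bounded_tac ]
  | |- _ => eassumption
  end.

Lemma residuals_bounded M : exists K, 0 <= K /\
  forall eps del u v, 0 <= eps <= 1 -> 0 <= del <= 1 ->
    l2 u -> nrm u <= M -> l2 v -> nrm v <= M ->
    (l2 (approx eps del u v) /\ nrm (approx eps del u v) <= K) /\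
    (l2 (residual1 eps del u v) /\ nrm (residual1 eps del u v) <= K) /\
    (l2 (residual2 eps del u v) /\ nrm (residual2 eps del u v) <= K).
Proof.
  assert (Bu : uniformly_bounded (admissible M) p_u).
  { exists (Rabs M); split; [apply Rabs_pos|]; intros p (_ & [H H'] & _).
    split; trivial; apply Rle_trans with (1 := H'), Rle_abs. }
  assert (Bv : uniformly_bounded (admissible M) p_v).
  { exists (Rabs M); split; [apply Rabs_pos|]; intros p (_ & _ & H & H').
    split; trivial; apply Rle_trans with (1 := H'), Rle_abs. }
  assert (BX : uniformly_bounded (admissible M)
                 (fun p => approx (p_eps p) (p_del p) (p_u p) (p_v p))).
  { unfold approx, re_cube; bounded_tac. }
  assert (BG : uniformly_bounded (admissible M)
                 (fun p => gterm (p_del p) (p_u p) (p_v p))).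
  { unfold gterm, cubic; bounded_tac. }
  assert (BH : uniformly_bounded (admissible M)
                 (fun p => hterm (p_eps p) (p_del p) (p_u p) (p_v p))).
  { unfold hterm; bounded_tac. }
  assert (BH' : uniformly_bounded (admissible M)
                 (fun p => hterm (p_eps p) (p_del p) (p_v p) (p_u p))).
  { unfold hterm, gterm, cubic; bounded_tac. }
  assert (B1 : uniformly_bounded (admissible M)
                 (fun p => residual1 (p_eps p) (p_del p) (p_u p) (p_v p))).
  { unfold residual1; bounded_tac. }
  assert (B2 : uniformly_bounded (admissible M)
                 (fun p => residual2 (p_eps p) (p_del p) (p_u p) (p_v p))).
  { unfold residual2, re_cube; cbv zeta; bounded_tac. }
  destruct BX as (KX & HX & BX), B1 as (K1 & H1 & B1), B2 as (K2 & H2 & B2).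
  exists (KX + K1 + K2); split; [lra|].
  intros eps del u v Heps Hdel Hu Hu' Hv Hv'.
  set (p := Build_nls_state eps del u v).
  assert (Hp : admissible M p) by (repeat split; simpl; trivial; lra).
  destruct (BX p Hp), (B1 p Hp), (B2 p Hp); simpl in *.
  repeat split; trivial; lra.
Qed.

(** * Conservation of the norm *)

Lemma rotating_flow_l2 eps del u v t : rotating_flow eps del u v -> l2 (u t) /\ l2 (v t).
Proof. intro F; destruct (F t) as [[Hu _] [Hv _]]; auto. Qed.

Lemma l2_gterm del u v : l2 u -> l2 v -> l2 (gterm del u v).
Proof. intros; unfold gterm, cubic; auto 8 using l2_add, l2_scal, l2_mul, l2_lap. Qed.

Lemma l2_hterm eps del u v : l2 u -> l2 v -> l2 (hterm eps del u v).
Proof. intros; unfold hterm; auto using l2_add, l2_scal, l2_lap, l2_gterm. Qed.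

(** Both sides apply the same self-adjoint operator: [lap] is symmetric, and the cubic term is
    multiplication by the common weight [u^2 + v^2]. This is what conserves the norm. *)
Lemma ip_hterm_sym eps del u v : l2 u -> l2 v ->
  ip u (hterm eps del v u) = ip v (hterm eps del u v).
Proof.
  intros Hu Hv; unfold hterm, gterm.
  assert (Hc : ip u (cubic v u) = ip v (cubic u v))
    by (unfold ip, cubic; f_equal; seq_ring).
  assert (L1 : ip u (lap v) = ip v (lap u)) by (rewrite <- ip_lap, ip_comm; trivial).
  assert (L2 : ip u (lap (lap v)) = ip v (lap (lap u))).
  { rewrite <- (ip_lap u (lap v)), <- (ip_lap v (lap u)) by auto using l2_lap.
    apply ip_comm. }
  assert (l2 (cubic u v)) by (unfold cubic; auto using l2_add, l2_mul).
  assert (l2 (cubic v u)) by (unfold cubic; auto using l2_add, l2_mul).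
  repeat first [ rewrite ip_add_r by auto 10 using l2_add, l2_scal, l2_lap
               | rewrite ip_scal_r ].
  now rewrite Hc, L1, L2.
Qed.

Lemma constant_of_derive_zero (f : R -> R) : (forall t, is_derive f t 0) -> forall t, f t = f 0.
Proof.
  intros H t; destruct (Rtotal_order t 0) as [Ht|[->|Ht]]; trivial.
  - apply (eq_is_derive f t 0); auto; intros; apply H.
  - symmetry; apply (eq_is_derive f 0 t); auto; intros; apply H.
Qed.

Lemma rotating_flow_conserved eps del u v t : rotating_flow eps del u v ->
  ip (u t) (u t) + ip (v t) (v t) = ip (u 0) (u 0) + ip (v 0) (v 0).
Proof.
  intro F.
  apply (constant_of_derive_zero (fun t => ip (u t) (u t) + ip (v t) (v t))).
  clear t; intro t; destruct (F t) as [Du Dv].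
  destruct (rotating_flow_l2 _ _ _ _ t F) as [Hu Hv].
  pose proof (l2_hterm eps del _ _ Hu Hv) as HH.
  pose proof (l2_hterm eps del _ _ Hv Hu) as HG.
  assert (D := is_derive_plus _ _ _ _ _ (is_derive_ip _ _ _ _ _ Du Du)
                                        (is_derive_ip _ _ _ _ _ Dv Dv)).
  match type of D with is_derive _ _ ?l => replace 0 with l; [exact D|] end.
  unfold plus; simpl.
  rewrite !(ip_comm (sadd _ _)), !ip_add_r, !ip_scal_r by auto using l2_add, l2_scal.
  rewrite (ip_hterm_sym _ _ _ _ Hu Hv), (ip_comm (v t) (u t)); ring.
Qed.

(** For the rotated gdNLS solution the rotation is trivial at time zero, so the right-hand sides
    depend on the initial data alone, neither on [t] nor on [eps]. *)
Lemma rotating_flow_bound eps del u v t : rotating_flow eps del u v ->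
  nrm (u t) <= nrm (u 0) + nrm (v 0) /\ nrm (v t) <= nrm (u 0) + nrm (v 0).
Proof.
  intro F; pose proof (rotating_flow_conserved _ _ _ _ t F) as Hc.
  destruct (rotating_flow_l2 _ _ _ _ t F) as [Hu Hv].
  destruct (rotating_flow_l2 _ _ _ _ 0 F) as [Hu0 Hv0].
  pose proof (nrm_pos (u 0)); pose proof (nrm_pos (v 0)).
  pose proof (ip_pos _ Hu); pose proof (ip_pos _ Hv).
  rewrite <- (nrm_sq (u 0)), <- (nrm_sq (v 0)) in Hc by trivial.
  split; apply nrm_le_sq; trivial; nra.
Qed.

(** * From the complex gdNLS equation to the rotating real system *)

Definition re_part (a : R -> Z -> C) : R -> Z -> R := fun s j => Re (a s j).
Definition im_part (a : R -> Z -> C) : R -> Z -> R := fun s j => Im (a s j).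

Lemma Re_le_norm (z : C) : Rabs (Re z) <= norm (V := C_R_NormedModule) z.
Proof.
  rewrite norm_C_R; eapply Rle_trans; [apply Rmax_l | apply Rmax_Cmod].
Qed.

Lemma Im_le_norm (z : C) : Rabs (Im z) <= norm (V := C_R_NormedModule) z.
Proof.
  rewrite norm_C_R; eapply Rle_trans; [apply Rmax_r | apply Rmax_Cmod].
Qed.

Lemma dl2_re_part a t a' : is_ell2_derive (V := C_R_NormedModule) a t a' ->
  dl2 (re_part a) t (fun j => Re (a' j)).
Proof.
  apply (dl2_contract (V := C_R_NormedModule) Re); trivial; apply Re_le_norm.
Qed.

Lemma dl2_im_part a t a' : is_ell2_derive (V := C_R_NormedModule) a t a' ->
  dl2 (im_part a) t (fun j => Im (a' j)).
Proof.
  apply (dl2_contract (V := C_R_NormedModule) Im); trivial; apply Im_le_norm.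
Qed.

Definition rot_re (eps : R) (a : R -> Z -> C) : R -> Z -> R := fun s =>
  sadd (sscal (cos s) (re_part a (eps * s))) (sscal (- sin s) (im_part a (eps * s))).
Definition rot_im (eps : R) (a : R -> Z -> C) : R -> Z -> R := fun s =>
  sadd (sscal (sin s) (re_part a (eps * s))) (sscal (cos s) (im_part a (eps * s))).

Lemma Cmod_sq (z : C) : Cmod z ^ 2 = Re z ^ 2 + Im z ^ 2.
Proof.
  unfold Cmod; rewrite pow2_sqrt; trivial.
  apply Rplus_le_le_0_compat; apply pow2_ge_0.
Qed.

Lemma lap_lap x j : lap (lap x) j = x (j + 2)%Z + 2 * x j + x (j - 2)%Z.
Proof.
  unfold lap, sadd, translate.
  replace (j + 1 + 1)%Z with (j + 2)%Z by lia; replace (j + 1 + -1)%Z with j by lia.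
  replace (j + -1 + 1)%Z with j by lia; replace (j + -1 + -1)%Z with (j - 2)%Z by lia.
  ring.
Qed.

Lemma gdNLS_components eps del a0 a t : solves_gdNLS eps del a0 a ->
  dl2 (re_part a) t (hterm eps del (im_part a t) (re_part a t)) /\
  dl2 (im_part a) t (sscal (-1) (hterm eps del (re_part a t) (im_part a t))).
Proof.
  intros [_ Ha]; destruct (Ha t) as (a' & Da & Heq).
  split; [eapply dl2_ext; [intro; reflexivity| |exact (dl2_re_part _ _ _ Da)]
         |eapply dl2_ext; [intro; reflexivity| |exact (dl2_im_part _ _ _ Da)]];
    apply functional_extensionality; intro j; specialize (Heq j);
    rewrite Cmod_sq in Heq; unfold hterm, gterm, cubic, sadd, sscal, smul; rewrite lap_lap;
    unfold lap, sadd, translate, re_part, im_part;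
    change (j + -1)%Z with (j - 1)%Z;
    (* The factor [2 * Ci] puts the derivative of the real part into the imaginary part of the
       equation, and conversely. *)
    [ apply (f_equal Im) in Heq | apply (f_equal Re) in Heq ];
    unfold Re, Im, RtoC, Ci, Cmult, Cplus in *; simpl in *; lra.
Qed.

Lemma gdNLS_rotating_flow eps del a0 a : solves_gdNLS eps del a0 a ->
  rotating_flow eps del (rot_re eps a) (rot_im eps a).
Proof.
  intros Ha t; destruct (gdNLS_components _ _ _ _ (eps * t) Ha) as [Dp Dq].
  apply dl2_dilate in Dp; apply dl2_dilate in Dq.
  assert (Hcos : is_derive cos t (- sin t)) by (auto_derive; trivial; ring).
  assert (Hsin : is_derive sin t (cos t)) by (auto_derive; trivial; ring).
  assert (Hsin' : is_derive (fun s => - sin s) t (- cos t)) by (auto_derive; trivial; ring).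
  pose proof (sin2_cos2 t) as Hsc; unfold Rsqr in Hsc.
  unfold rot_re, rot_im; set (p := re_part a (eps * t)) in *; set (q := im_part a (eps * t)) in *.
  set (U := sadd (sscal (cos t) p) (sscal (- sin t) q)).
  set (W := sadd (sscal (sin t) p) (sscal (cos t) q)).
  (* The weight [|z|^2] is the only nonlinear ingredient of [hterm] and is invariant under rotation;
     once it is rewritten, [hterm] acts linearly and commutes with the rotation. *)
  assert (Hsq : sadd (smul U U) (smul W W) = sadd (smul p p) (smul q q)).
  { transitivity (sscal (sin t * sin t + cos t * cos t) (sadd (smul p p) (smul q q))).
    - unfold U, W; seq_ring.
    - rewrite Hsc; seq_ring. }
  assert (Hsq' : sadd (smul W W) (smul U U) = sadd (smul p p) (smul q q))
    by (rewrite <- Hsq; seq_ring).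
  split.
  - eapply dl2_ext; [intro; reflexivity| |].
    2: exact (dl2_add _ _ _ _ _ (dl2_scal_fun _ _ _ _ _ Hcos Dp)
                                (dl2_scal_fun _ _ _ _ _ Hsin' Dq)).
    simpl; fold p q; unfold hterm, gterm, cubic; rewrite Hsq'.
    unfold W; rewrite ?lap_add, ?lap_scal, ?lap_add, ?lap_scal.
    seq_ring.
  - eapply dl2_ext; [intro; reflexivity| |].
    2: exact (dl2_add _ _ _ _ _ (dl2_scal_fun _ _ _ _ _ Hsin Dp)
                                (dl2_scal_fun _ _ _ _ _ Hcos Dq)).
    simpl; fold p q; unfold hterm, gterm, cubic; rewrite Hsq.
    unfold U; rewrite ?lap_add, ?lap_scal, ?lap_add, ?lap_scal.
    seq_ring.
Qed.

Lemma leading_approx_rot eps del a t :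
  leading_approx eps (del * eps ^ 2) a t = approx eps del (rot_re eps a t) (rot_im eps a t).
Proof.
  assert (Hc3 : cos (3 * t) = cos t * (cos t * cos t - 3 * (sin t * sin t))).
  { replace (3 * t) with (t + t + t) by ring; rewrite !cos_plus, sin_plus; ring. }
  assert (Hs3 : sin (3 * t) = sin t * (3 * (cos t * cos t) - sin t * sin t)).
  { replace (3 * t) with (t + t + t) by ring; rewrite !sin_plus, cos_plus; ring. }
  apply functional_extensionality; intro j.
  unfold leading_approx, leading_approx_C, approx, re_cube, rot_re, rot_im, re_part, im_part,
    expi, sadd, smul, sscal; cbv zeta.
  rewrite !cos_neg, !sin_neg, Hc3, Hs3.
  destruct (a (eps * t) j) as [x y].
  unfold Re, Im, RtoC, Cconj, Cmult, Cplus; simpl; field.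
Qed.
(** * Energy estimate *)

(** The function [exp (-k s) (b + E) / (1 + E)] is nonincreasing, since the quotient has derivative
    [(1 - b) E' / (1 + E)^2]. At time zero the denominator is at least one and is dropped. *)
Lemma growth_forward (E E' : R -> R) (b k t : R) : 0 <= b <= 1 -> 0 <= k -> 0 <= t ->
  (forall s, 0 <= s <= t -> is_derive E s (E' s) /\ 0 <= E s /\
                            E' s <= k * (b + E s) * (1 + E s)) ->
  b + E t <= exp (k * t) * (b + E 0) * (1 + E t).
Proof.
  intros Hb Hk Ht H.
  set (f := fun s => exp (- (k * s)) * ((b + E s) / (1 + E s))).
  set (df := fun s => exp (- (k * s)) *
    ((1 - b) * E' s / (1 + E s) ^ 2 - k * ((b + E s) / (1 + E s)))).
  assert (Df : forall s, 0 <= s <= t -> is_derive f s (df s)).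
  { intros s Hs; destruct (H s Hs) as (HD & Hp & _); unfold f, df.
    auto_derive.
    - split; [exists (E' s); exact HD|]; split; [|split; [lra | trivial]].
      exists (E' s); exact HD.
    - replace (Derive (fun x : R => E x) s) with (E' s)
        by (symmetry; exact (is_derive_unique _ _ _ HD)).
      field; lra. }
  destruct (MVT_gen f 0 t df) as (c & Hc & Heq).
  - intros s Hs; rewrite Rmin_left, Rmax_right in Hs by trivial; apply Df; lra.
  - intros s Hs; rewrite Rmin_left, Rmax_right in Hs by trivial.
    apply continuity_pt_filterlim, (ex_derive_continuous f); exists (df s); now apply Df.
  - rewrite Rmin_left, Rmax_right in Hc by trivial.
    destruct (H c Hc) as (_ & Hp & Hle).
    assert (Hdf : df c <= 0).
    { unfold df; replace (_ - _) with ((1 - b) * E' c / (1 + E c) ^ 2 - k * (b + E c) * (1 + E c) / (1 + E c) ^ 2)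
        by (field; lra).
      rewrite <- (Rmult_0_r (exp (- (k * c)))); apply Rmult_le_compat_l.
      - left; apply exp_pos.
      - apply Rle_minus, Rmult_le_compat_r.
        + left; apply Rinv_0_lt_compat; nra.
        + assert (0 <= k * (b + E c) * (1 + E c)) by (repeat apply Rmult_le_pos; lra).
          (* As [0 <= 1 - b <= 1], the product [(1 - b) E'] is at most [E'] when [E'] is positive
             and at most zero otherwise. *)
          destruct (Rle_lt_dec (E' c) 0); nra. }
    assert (Hf : f t <= f 0) by nra.
    destruct (H t) as (_ & Hpt & _); [lra|]; destruct (H 0) as (_ & Hp0 & _); [lra|].
    unfold f in Hf; rewrite Rmult_0_r, Ropp_0, exp_0, Rmult_1_l in Hf.
    assert (Hexp : exp (- (k * t)) * exp (k * t) = 1)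
      by (rewrite <- exp_plus; replace (- (k * t) + k * t) with 0 by ring; apply exp_0).
    pose proof (exp_pos (k * t)).
    assert (HE0 : (b + E 0) / (1 + E 0) <= b + E 0).
    { apply Rle_div_l; [lra|]; nra. }
    apply Rle_div_l; [lra|].
    replace ((b + E t) / (1 + E t)) with
      (exp (- (k * t)) * ((b + E t) / (1 + E t)) * exp (k * t)).
    + rewrite (Rmult_comm (exp (k * t))); apply Rmult_le_compat_r; lra.
    + transitivity (exp (- (k * t)) * exp (k * t) * ((b + E t) / (1 + E t))); [ring|].
      rewrite Hexp; ring.
Qed.

(* [E' <= k (b + E) (1 + E)] integrates globally as [d/dt log ((b + E) / (1 + E)) <= k],
   so no continuation argument is needed to absorb the superlinear term. *)
Lemma growth_bound (E E' : R -> R) (b k T : R) : 0 <= b <= 1 -> 0 <= k ->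
  (forall s, Rabs s < T -> is_derive E s (E' s) /\ 0 <= E s /\
                           Rabs (E' s) <= k * (b + E s) * (1 + E s)) ->
  forall t, Rabs t < T -> b + E t <= exp (k * Rabs t) * (b + E 0) * (1 + E t).
Proof.
  intros Hb Hk H t HtT; destruct (Rle_lt_dec 0 t) as [Ht|Ht].
  - rewrite (Rabs_pos_eq t) in * by trivial.
    apply growth_forward with (E' := E'); trivial; intros s Hs.
    destruct (H s) as (HD & Hp & Hle); [rewrite Rabs_pos_eq; lra|].
    apply Rabs_le_between in Hle; split; [exact HD | lra].
  - rewrite (Rabs_left t) in * by trivial.
    pose proof (growth_forward (fun s => E (- s)) (fun s => - E' (- s)) b k (- t)) as G.
    simpl in G; rewrite Ropp_involutive, Ropp_0 in G; apply G; trivial; [lra|].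
    intros s Hs; destruct (H (- s)) as (HD & Hp & Hle); [rewrite Rabs_Ropp, Rabs_pos_eq; lra|].
    apply Rabs_le_between in Hle; split; [|lra].
    replace (- E' (- s)) with (scal (-1) (E' (- s)))
      by (unfold scal; simpl; unfold mult; simpl; ring).
    apply (is_derive_comp E Ropp); trivial.
    auto_derive; trivial; ring.
Qed.

Definition energy (eps : R) (y w : Z -> R) : R := ip w w + ip y y - eps * ip y (lap y).

(** [lap] has norm at most 2, so the threshold 1/4 keeps the coupling term below half of [|y|^2]. *)
Lemma energy_equiv eps y w : 0 <= eps <= / 4 -> l2 y -> l2 w ->
  (nrm w ^ 2 + nrm y ^ 2) / 2 <= energy eps y w <= 2 * (nrm w ^ 2 + nrm y ^ 2).
Proof.
  intros He Hy Hw; unfold energy; rewrite <- !nrm_sq by trivial.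
  pose proof (cauchy_schwarz _ _ Hy (l2_lap _ Hy)) as CS.
  pose proof (nrm_lap _ Hy); pose proof (nrm_pos y); pose proof (pow2_ge_0 (nrm w)).
  assert (B : Rabs (ip y (lap y)) <= 2 * nrm y ^ 2) by (simpl; nra).
  apply Rabs_le_between in B; pose proof (pow2_ge_0 (nrm y)); nra.
Qed.

(* [xi^3 - X^3] for [xi = X + y]. *)
Definition cubic_diff (X y : Z -> R) : Z -> R :=
  smul y (sadd (sscal 3 (smul X X)) (sadd (sscal 3 (smul X y)) (smul y y))).

Lemma l2_cubic_diff X y : l2 X -> l2 y -> l2 (cubic_diff X y).
Proof. intros; unfold cubic_diff; auto 8 using l2_add, l2_scal, l2_mul. Qed.

Lemma nrm_cubic_diff X y K : l2 X -> l2 y -> nrm X <= K ->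
  nrm (cubic_diff X y) <= nrm y * (3 * K ^ 2 + 3 * K * nrm y + nrm y ^ 2).
Proof.
  intros HX Hy HK; pose proof (nrm_pos X); pose proof (nrm_pos y).
  unfold cubic_diff; eapply Rle_trans; [apply nrm_mul; auto 8 using l2_add, l2_scal, l2_mul|].
  apply Rmult_le_compat_l; trivial.
  eapply Rle_trans; [apply nrm_add; auto 8 using l2_add, l2_scal, l2_mul|].
  rewrite Rplus_assoc; apply Rplus_le_compat.
  - rewrite nrm_scal, (Rabs_pos_eq 3) by lra; apply Rmult_le_compat_l; [lra|].
    eapply Rle_trans; [apply nrm_mul; trivial|]; simpl; nra.
  - eapply Rle_trans; [apply nrm_add; auto 8 using l2_add, l2_scal, l2_mul|].
    rewrite nrm_scal, (Rabs_pos_eq 3) by lra; apply Rplus_le_compat.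
    + rewrite Rmult_assoc; apply Rmult_le_compat_l; [lra|].
      eapply Rle_trans; [apply nrm_mul; trivial|]; nra.
    + eapply Rle_trans; [apply nrm_mul; trivial|]; lra.
Qed.

(** The linear lattice flow conserves the energy, by symmetry of [lap]. Only the cubic term and the
    residuals survive, so the rate has no term of order [eps] without a factor [rho] or [mu]. *)
Lemma energy_derive eps rho mu (y w : R -> Z -> R) t X r1 r2 :
  l2 X -> l2 r1 -> l2 r2 ->
  dl2 y t (sadd (w t) (sscal (- mu) r1)) ->
  dl2 w t (sadd (sadd (sscal (-1) (y t)) (sscal eps (lap (y t))))
                (sadd (sscal (- rho) (cubic_diff X (y t))) (sscal (- mu) r2))) ->
  is_derive (fun s => energy eps (y s) (w s)) t
    (- 2 * (rho * ip (w t) (cubic_diff X (y t)) + mu * ip (w t) r2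
            + mu * (ip (y t) r1 - eps * ip (lap (y t)) r1))).
Proof.
  intros HX H1 H2 Dy Dw.
  assert (Hy : l2 (y t)) by apply Dy; assert (Hw : l2 (w t)) by apply Dw.
  pose proof (l2_cubic_diff X _ HX Hy) as HN.
  assert (D := is_derive_minus _ _ _ _ _
    (is_derive_plus _ _ _ _ _ (is_derive_ip _ _ _ _ _ Dw Dw) (is_derive_ip _ _ _ _ _ Dy Dy))
    (is_derive_scal _ _ eps _ (is_derive_ip _ _ _ _ _ Dy (dl2_lap _ _ _ Dy)))).
  match type of D with is_derive _ _ ?l =>
    match goal with |- is_derive _ _ ?m => replace m with l; [exact D|] end end.
  unfold minus, plus, opp, scal, mult; simpl; unfold mult; simpl.
  rewrite !lap_add, !lap_scal.
  set (N := cubic_diff X (y t)) in *; set (Y := y t) in *; set (W := w t) in *.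
  repeat first [ rewrite ip_add_l by auto 10 using l2_add, l2_scal, l2_lap
               | rewrite ip_add_r by auto 10 using l2_add, l2_scal, l2_lap
               | rewrite ip_scal_l | rewrite ip_scal_r ].
  rewrite (ip_comm N W), (ip_comm r2 W), (ip_comm r1 Y), (ip_comm r1 (lap Y)),
    (ip_comm (lap Y) W), (ip_comm Y W), <- (ip_lap Y r1), <- (ip_lap Y W), (ip_comm (lap Y) W)
    by trivial.
  ring.
Qed.

(** The cubic term is bounded by [2 W Y <= W^2 + Y^2] times a quadratic polynomial, giving
    [3 K^2 + 3 K + 1]; the residuals, by [2 eta W <= eta^2 + W^2] and its analogue for [Y], give the
    other [3 K]. *)
Lemma energy_rate_bound eps rho eta K Y W n r1 r2 z1 z2 :
  0 <= eps <= / 4 -> 0 <= rho -> 0 <= eta -> 0 <= K -> 0 <= Y -> 0 <= W ->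
  Rabs n <= W * (Y * (3 * K ^ 2 + 3 * K * Y + Y ^ 2)) ->
  Rabs r2 <= W * K -> Rabs z1 <= Y * K -> Rabs z2 <= 2 * Y * K -> r1 = z1 - eps * z2 ->
  Rabs (- 2 * (rho * n + rho * eta * r2 + rho * eta * r1)) <=
  rho * ((3 * K ^ 2 + 6 * K + 1) * (eta ^ 2 + (W ^ 2 + Y ^ 2)) * (1 + (W ^ 2 + Y ^ 2))).
Proof.
  intros He Hrho Heta HK HY HW Hn H2 Hz1 Hz2 ->.
  replace (- 2 * (rho * n + rho * eta * r2 + rho * eta * (z1 - eps * z2)))
    with (rho * (- 2 * (n + eta * (r2 + (z1 - eps * z2))))) by ring.
  rewrite Rabs_mult, (Rabs_pos_eq rho) by trivial.
  apply Rmult_le_compat_l; trivial.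
  remember (W ^ 2 + Y ^ 2) as S eqn:ES.
  assert (HS : 0 <= S) by (rewrite ES; nra).
  (* Here [eps <= / 4] turns the bound [2 Y K] on [z2] into [Y K / 2], whence the factor 3/2. *)
  assert (A : Rabs (r2 + (z1 - eps * z2)) <= W * K + 3 / 2 * (Y * K)).
  { apply Rabs_le_between in H2; apply Rabs_le_between in Hz1; apply Rabs_le_between in Hz2.
    assert (0 <= Y * K) by nra; apply Rabs_le; nra. }
  assert (B : Rabs (- 2 * (n + eta * (r2 + (z1 - eps * z2))))
              <= 2 * (W * (Y * (3 * K ^ 2 + 3 * K * Y + Y ^ 2)))
                 + 2 * (eta * (W * K + 3 / 2 * (Y * K)))).
  { rewrite Rabs_mult, Rabs_left by lra.
    eapply Rle_trans; [apply Rmult_le_compat_l; [lra | apply Rabs_triang]|].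
    rewrite Rabs_mult, (Rabs_pos_eq eta) by trivial; nra. }
  apply Rle_trans with (1 := B).
  assert (P : 3 * K ^ 2 + 3 * K * Y + Y ^ 2 <= (3 * K ^ 2 + 3 * K + 1) * (1 + S)).
  { assert (Y <= 1 + S) by (rewrite ES; nra); assert (Y ^ 2 <= 1 + S) by (rewrite ES; nra).
    assert (K * Y <= K * (1 + S)) by (apply Rmult_le_compat_l; trivial).
    assert (0 <= K ^ 2 * S) by (apply Rmult_le_pos; trivial; apply pow2_ge_0). lra. }
  assert (Q1 : 2 * (W * Y) <= S)
    by (rewrite ES; pose proof (pow2_ge_0 (W - Y)); lra).
  assert (Q2 : 2 * (W * (Y * (3 * K ^ 2 + 3 * K * Y + Y ^ 2)))
               <= S * ((3 * K ^ 2 + 3 * K + 1) * (1 + S))).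
  { replace (2 * (W * (Y * (3 * K ^ 2 + 3 * K * Y + Y ^ 2))))
      with (2 * (W * Y) * (3 * K ^ 2 + 3 * K * Y + Y ^ 2)) by ring.
    assert (0 <= K * Y) by nra; pose proof (pow2_ge_0 K); pose proof (pow2_ge_0 Y).
    apply Rmult_le_compat; trivial; [nra | lra]. }
  assert (Q3 : 2 * (eta * (W * K + 3 / 2 * (Y * K))) <= 3 * K * (eta ^ 2 + S)).
  { assert (2 * eta * W <= eta ^ 2 + W ^ 2)
      by (pose proof (pow2_ge_0 (eta - W)); lra).
    assert (2 * eta * Y <= eta ^ 2 + Y ^ 2)
      by (pose proof (pow2_ge_0 (eta - Y)); lra).
    assert (2 * eta * W + 3 * eta * Y <= 3 * (eta ^ 2 + S)) by (rewrite ES; nra). nra. }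
  assert (0 <= eta ^ 2) by apply pow2_ge_0.
  assert (0 <= K ^ 2) by apply pow2_ge_0.
  assert (Q4 : 3 * K * (eta ^ 2 + S) <= 3 * K * (eta ^ 2 + S) * (1 + S)).
  { assert (0 <= 3 * K * (eta ^ 2 + S)) by (apply Rmult_le_pos; lra); nra. }
  assert (Q5 : S * ((3 * K ^ 2 + 3 * K + 1) * (1 + S))
               <= (eta ^ 2 + S) * ((3 * K ^ 2 + 3 * K + 1) * (1 + S))).
  { apply Rmult_le_compat_r; [apply Rmult_le_pos; lra | lra]. }
  lra.
Qed.

(** * Equations for the errors, and the conclusion *)

Definition pos_err (eps del : R) (u v xi : R -> Z -> R) (s : R) : Z -> R :=
  sadd (xi s) (sscal (-1) (approx eps del (u s) (v s))).
Definition vel_err (eps del : R) (u v xi : R -> Z -> R) (s : R) : Z -> R :=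
  sadd (dot xi s) (sscal (-1) (approx_vel eps del (u s) (v s))).

Lemma dl2_pos_err eps del u v xi T t : rotating_flow eps del u v ->
  solves_dKG eps (del * eps ^ 2) T xi -> Rabs t < T ->
  dl2 (pos_err eps del u v xi) t
    (sadd (vel_err eps del u v xi t) (sscal (- eps ^ 3) (residual1 eps del (u t) (v t)))).
Proof.
  intros F Hxi Ht; destruct (Hxi t Ht) as (D0 & _ & _); apply dl2_of_real in D0.
  eapply dl2_ext; [intro; reflexivity| |].
  2: exact (dl2_add _ _ _ _ _ D0 (dl2_scal (-1) _ _ _ (dl2_approx eps del u v t F))).
  unfold vel_err; seq_ring.
Qed.

Lemma dl2_vel_err eps del u v xi T t : rotating_flow eps del u v ->
  solves_dKG eps (del * eps ^ 2) T xi -> Rabs t < T ->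
  let y := pos_err eps del u v xi t in
  dl2 (vel_err eps del u v xi) t
    (sadd (sadd (sscal (-1) y) (sscal eps (lap y)))
          (sadd (sscal (- (del * eps ^ 2)) (cubic_diff (approx eps del (u t) (v t)) y))
                (sscal (- eps ^ 3) (residual2 eps del (u t) (v t))))).
Proof.
  intros F Hxi Ht y; destruct (Hxi t Ht) as (_ & D1 & Heq); apply dl2_of_real in D1.
  eapply dl2_ext; [intro; reflexivity| |].
  2: exact (dl2_add _ _ _ _ _ D1 (dl2_scal (-1) _ _ _ (dl2_approx_vel eps del u v t F))).
  unfold y, pos_err; rewrite lap_add, lap_scal.
  set (X := approx eps del (u t) (v t)); set (r := residual2 eps del (u t) (v t)).
  apply functional_extensionality; intro j; specialize (Heq j).
  assert (Hlap : lap (xi t) j = xi t (j + 1)%Z + xi t (j - 1)%Z) by reflexivity.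
  rewrite <- Hlap in Heq.
  unfold cubic_diff, sadd, sscal, smul.
  replace (dot (dot xi) t j)
    with (eps * lap (xi t) j - xi t j - del * eps ^ 2 * xi t j ^ 3) by lra.
  ring.
Qed.

Lemma energy_growth eps del eta K T u v xi :
  0 <= eps <= / 4 -> 0 <= del * eps ^ 2 -> 0 <= eta <= 1 -> eps ^ 3 = del * eps ^ 2 * eta ->
  0 <= K -> rotating_flow eps del u v -> solves_dKG eps (del * eps ^ 2) T xi ->
  (forall t, (l2 (approx eps del (u t) (v t)) /\ nrm (approx eps del (u t) (v t)) <= K) /\
             (l2 (residual1 eps del (u t) (v t)) /\ nrm (residual1 eps del (u t) (v t)) <= K) /\
             (l2 (residual2 eps del (u t) (v t)) /\ nrm (residual2 eps del (u t) (v t)) <= K)) ->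
  let E s := energy eps (pos_err eps del u v xi s) (vel_err eps del u v xi s) in
  forall t, Rabs t < T ->
  eta ^ 2 + E t <=
    exp (4 * (3 * K ^ 2 + 6 * K + 1) * (del * eps ^ 2) * Rabs t) * (eta ^ 2 + E 0) * (1 + E t).
Proof.
  intros He Hrho Heta Hmu HK F Hxi HB E.
  set (c := 3 * K ^ 2 + 6 * K + 1); set (rho := del * eps ^ 2) in *.
  assert (Hc : 0 <= c) by (unfold c; nra).
  eapply growth_bound; [simpl; nra | apply Rmult_le_pos; [lra | exact Hrho] |].
  intros s Hs; destruct (HB s) as ([LX NX] & [L1 N1] & [L2 N2]).
  pose proof (dl2_pos_err _ _ _ _ _ _ _ F Hxi Hs) as Dy.
  pose proof (dl2_vel_err _ _ _ _ _ _ _ F Hxi Hs) as Dw; simpl in Dw.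
  change (del * (eps * (eps * 1))) with rho in Dw.
  change (eps * (eps * (eps * 1))) with (eps ^ 3) in Dw.
  split; [exact (energy_derive _ _ _ _ _ _ _ _ _ LX L1 L2 Dy Dw)|].
  assert (Hy := proj1 Dy); assert (Hw := proj1 Dw).
  unfold E; set (y := pos_err eps del u v xi s) in *; set (w := vel_err eps del u v xi s) in *.
  pose proof (energy_equiv eps y w He Hy Hw) as HE.
  pose proof (nrm_pos y) as Py; pose proof (nrm_pos w) as Pw.
  assert (PS : 0 <= nrm w ^ 2 + nrm y ^ 2) by (simpl; nra).
  split; [lra|].
  rewrite Hmu; eapply Rle_trans.
  - apply (energy_rate_bound eps rho eta K (nrm y) (nrm w) _ _ _ (ip y (residual1 eps del (u s) (v s)))
             (ip (lap y) (residual1 eps del (u s) (v s)))); trivial; try lra.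
    + eapply Rle_trans; [apply cauchy_schwarz; trivial; now apply l2_cubic_diff|].
      apply Rmult_le_compat_l; trivial; now apply nrm_cubic_diff.
    + eapply Rle_trans; [apply cauchy_schwarz; trivial|]; now apply Rmult_le_compat_l.
    + eapply Rle_trans; [apply cauchy_schwarz; trivial|]; now apply Rmult_le_compat_l.
    + eapply Rle_trans; [apply cauchy_schwarz; auto using l2_lap|].
      apply Rmult_le_compat; trivial; try apply nrm_pos; now apply nrm_lap.
  (* Replacing the squared norms by the energy costs a factor 2 in each of the two factors, hence
     the 4 in the exponent. *)
  - fold c; set (S := nrm w ^ 2 + nrm y ^ 2) in *; set (e := energy eps y w) in *.
    assert (0 <= eta ^ 2) by apply pow2_ge_0.
    assert (H1 : (eta ^ 2 + S) * (1 + S) <= (2 * (eta ^ 2 + e)) * (2 * (1 + e)))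
      by (apply Rmult_le_compat; lra).
    apply Rle_trans with (rho * c * ((2 * (eta ^ 2 + e)) * (2 * (1 + e)))); [|lra].
    replace (rho * (c * (eta ^ 2 + S) * (1 + S))) with (rho * c * ((eta ^ 2 + S) * (1 + S))) by ring.
    apply Rmult_le_compat_l; trivial; now apply Rmult_le_pos.
Qed.

(* [y], [w], [dy] are the norms of the position error, of the velocity error relative
   to [approx_vel] and of the velocity error relative to the true derivative. *)
Lemma close_estimate eta K L y0 dy0 w0 E0 y dy w E :
  0 <= eta -> 0 <= K -> 1 <= L ->
  0 <= y0 -> 0 <= dy0 -> 0 <= w0 -> 0 <= y -> 0 <= w ->
  y0 + dy0 <= eta -> w0 <= dy0 + K * eta -> E0 <= 2 * (w0 ^ 2 + y0 ^ 2) ->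
  (w ^ 2 + y ^ 2) / 2 <= E -> dy <= w + K * eta ->
  eta ^ 2 + E <= L * (eta ^ 2 + E0) * (1 + E) ->
  eta <= / (2 * (L * (1 + 2 * (1 + K) ^ 2))) ->
  y + dy <= (8 * (L * (1 + 2 * (1 + K) ^ 2)) + K) * eta.
Proof.
  intros Heta HK HL Hy0 Hdy0 Hw0 Hy Hw H0 Hw0' HE0 HE Hdy Hgr Hsmall.
  set (Q := 1 + 2 * (1 + K) ^ 2) in *.
  assert (HQ : 1 <= Q) by (unfold Q; pose proof (pow2_ge_0 (1 + K)); lra).
  assert (HLQ : 1 <= L * Q) by nra.
  set (P := L * Q) in *.
  assert (HEpos : 0 <= E) by (pose proof (pow2_ge_0 w); pose proof (pow2_ge_0 y); lra).
  assert (HP : eta * (2 * P) <= 1).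
  { apply Rmult_le_compat_r with (r := 2 * P) in Hsmall; [|lra].
    rewrite Rinv_l in Hsmall by lra; exact Hsmall. }
  assert (A : w0 ^ 2 + y0 ^ 2 <= (1 + K) ^ 2 * eta ^ 2).
  { rewrite <- Rpow_mult_distr.
    apply Rle_trans with ((w0 + y0) ^ 2); [nra|].
    apply pow_incr; lra. }
  assert (B : eta ^ 2 + E0 <= Q * eta ^ 2) by (unfold Q; lra).
  assert (C1 : L * (eta ^ 2 + E0) * (1 + E) <= P * eta ^ 2 * (1 + E)).
  { apply Rmult_le_compat_r; [lra|].
    unfold P; rewrite Rmult_assoc; apply Rmult_le_compat_l; lra. }
  assert (Heta1 : eta <= 1) by nra.
  assert (C2 : P * eta ^ 2 <= / 2).
  { replace (P * eta ^ 2) with (eta * (2 * P) * eta / 2) by field. nra. }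
  (* Smallness of [eta] absorbs the factor [1 + E]: since [P eta^2 <= 1/2], the growth bound gives
     [E <= P eta^2 + E / 2]. *)
  assert (C3 : E <= 2 * (P * eta ^ 2)) by (pose proof (pow2_ge_0 eta); nra).
  assert (D : (w + y) ^ 2 <= (8 * P * eta) ^ 2).
  { apply Rle_trans with (2 * (w ^ 2 + y ^ 2)); [pose proof (pow2_ge_0 (w - y)); lra|].
    apply Rle_trans with (8 * P * eta ^ 2); [lra|].
    rewrite Rpow_mult_distr; apply Rmult_le_compat_r; [apply pow2_ge_0 | nra]. }
  assert (D' : w + y <= 8 * P * eta).
  { apply Rsqr_incr_0_var; [unfold Rsqr; lra | nra]. }
  lra.
Qed.

Lemma dot_approx eps del u v t : rotating_flow eps del u v ->
  dot (fun s => approx eps del (u s) (v s)) t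
  = sadd (approx_vel eps del (u t) (v t)) (sscal (eps ^ 3) (residual1 eps del (u t) (v t))).
Proof.
  intro F; apply functional_extensionality; intro j.
  apply is_derive_unique, (dl2_entry _ _ _ j (dl2_approx _ _ _ _ t F)).
Qed.

Lemma asymptotic_range_small rho k : asymptotic_range rho -> 0 < k ->
  exists e0, 0 < e0 /\ forall eps, 0 < eps < e0 ->
    0 < rho eps /\ rho eps <= eps ^ 2 /\ eps ^ 3 / rho eps <= k.
Proof.
  intros [H1 H2] Hk.
  assert (H3 : at_right 0 (fun eps => eps ^ 3 / rho eps <= k)).
  { apply (H2 (fun z => z <= k)); exists (mkposreal k Hk); intros z Hz.
    unfold ball in Hz; simpl in Hz; unfold AbsRing_ball, abs, minus, plus, opp in Hz; simpl in Hz.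
    apply Rabs_lt_between in Hz; lra. }
  destruct (filter_and _ _ H1 H3) as [d Hd]; exists d; split; [apply cond_pos|].
  intros eps Heps; destruct (Hd eps) as [[Ha Hb] Hc]; [|lra|auto].
  unfold ball; simpl; unfold AbsRing_ball, abs, minus, plus, opp; simpl.
  apply Rabs_def1; lra.
Qed.

Theorem theorem3 :
  forall (rho : R -> R) (a0 : Z -> C),
  asymptotic_range rho ->
  ell2 (V := C_R_NormedModule) a0 ->
  forall tau0 : R, 0 < tau0 ->
  exists eps0 C0 C : R, 0 < eps0 /\ 0 < C0 /\ 0 < C /\
  forall eps : R, 0 < eps < eps0 ->
  forall a : R -> Z -> Complex.C,
  solves_gdNLS eps (rho eps / eps ^ 2) a0 a ->
  let X := leading_approx eps (rho eps) a in
  forall (T : R) (xi : R -> Z -> R),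
  0 < T ->
  solves_dKG eps (rho eps) T xi ->
  ell2_norm (V := R_NormedModule) (fun j => xi 0 j - X 0 j)
  + ell2_norm (V := R_NormedModule) (fun j => dot xi 0 j - dot X 0 j)
    <= C0 * (/ rho eps * eps ^ 3) ->
  forall t : R,
  - (tau0 / rho eps) <= t <= tau0 / rho eps ->
  Rabs t < T ->
  ell2_norm (V := R_NormedModule) (fun j => xi t j - X t j)
  + ell2_norm (V := R_NormedModule) (fun j => dot xi t j - dot X t j)
    <= C * (/ rho eps * eps ^ 3).
Proof.
  intros rho a0 Hrho Ha0 tau0 Htau.
  (* These norms of the initial data bound [u] and [v] at all times, so [K] is fixed before
     [eps]. *)
  destruct (residuals_bounded (nrm (fun j => Re (a0 j)) + nrm (fun j => Im (a0 j))))
    as (K & HK & HB).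
  set (c := 4 * (3 * K ^ 2 + 6 * K + 1)).
  assert (Hc : 0 <= c) by (unfold c; nra).
  (* [L] bounds the growth factor [exp (c rho |t|)] on the whole range [|t| <= tau0 / rho]. *)
  set (L := exp (c * tau0)).
  assert (HL : 1 <= L).
  { unfold L; rewrite <- exp_0; assert (0 <= c * tau0) by nra.
    destruct (Req_dec (c * tau0) 0) as [->|]; [lra|]; left; apply exp_increasing; lra. }
  set (P := L * (1 + 2 * (1 + K) ^ 2)).
  assert (HP : 1 <= P) by (unfold P; pose proof (pow2_ge_0 (1 + K)); nra).
  destruct (asymptotic_range_small rho (/ (2 * P)) Hrho) as (e0 & He0 & Hsmall);
    [apply Rinv_0_lt_compat; lra|].
  (* [e0] makes [eta] small enough to close the estimate, [/ 4] makes the energy equivalent to the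
     norms, and [C0 = 1] bounds the initial errors by [eta] itself. In [C], the term [8 P] comes
     from the energy and [K] from the omitted part of the velocity. *)
  exists (Rmin e0 (/ 4)), 1, (8 * P + K).
  split; [apply Rmin_pos; lra|]; split; [lra|]; split; [lra|].
  intros eps Heps a Ha X T xi HT Hxi Hinit t Ht HtT.
  assert (Heps4 : 0 < eps <= / 4) by (pose proof (Rmin_r e0 (/ 4)); lra).
  destruct (Hsmall eps) as (Hr0 & Hr2 & Heta); [pose proof (Rmin_l e0 (/ 4)); lra|].
  set (del := rho eps / eps ^ 2) in *.
  assert (He2 : 0 < eps ^ 2) by (apply pow_lt; lra).
  assert (Hdr : rho eps = del * eps ^ 2) by (unfold del; field; lra).
  assert (Hdel : 0 <= del <= 1).
  { unfold del; split; [apply Rle_div_r; lra | apply Rle_div_l; lra]. }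
  set (eta := / rho eps * eps ^ 3) in *.
  assert (Hmu : eps ^ 3 = del * eps ^ 2 * eta) by (unfold eta; rewrite Hdr; field; split; nra).
  replace (eps ^ 3 / rho eps) with eta in Heta by (unfold eta, Rdiv; ring).
  assert (Heta0 : 0 <= eta).
  { unfold eta; apply Rmult_le_pos; [left; now apply Rinv_0_lt_compat | apply pow_le; lra]. }
  assert (Heta1 : eta <= 1).
  { apply Rle_trans with (1 := Heta); rewrite <- Rinv_1; apply Rinv_le_contravar; lra. }
  pose proof (gdNLS_rotating_flow _ _ _ _ Ha) as F.
  set (u := rot_re eps a) in *; set (v := rot_im eps a) in *.
  assert (Hu0 : u 0 = fun j => Re (a0 j)).
  { apply functional_extensionality; intro j; unfold u, rot_re, re_part, im_part, sadd, sscal.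
    rewrite Rmult_0_r, cos_0, sin_0, (proj1 Ha); ring. }
  assert (Hv0 : v 0 = fun j => Im (a0 j)).
  { apply functional_extensionality; intro j; unfold v, rot_im, re_part, im_part, sadd, sscal.
    rewrite Rmult_0_r, cos_0, sin_0, (proj1 Ha); ring. }
  rewrite <- Hu0, <- Hv0 in HB.
  assert (Heps1 : 0 <= eps <= 1) by lra.
  pose proof (fun s => HB eps del (u s) (v s) Heps1 Hdel
    (proj1 (rotating_flow_l2 _ _ _ _ s F)) (proj1 (rotating_flow_bound _ _ _ _ s F))
    (proj2 (rotating_flow_l2 _ _ _ _ s F)) (proj2 (rotating_flow_bound _ _ _ _ s F))) as HB'.
  clear HB.
  assert (HX : X = fun s => approx eps del (u s) (v s)).
  { apply functional_extensionality; intro s; unfold X; rewrite Hdr; apply leading_approx_rot. }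
  rewrite HX, !dot_approx in * by trivial.
  rewrite Hdr in Hxi.
  set (y := pos_err eps del u v xi); set (w := vel_err eps del u v xi).
  assert (Ey : forall s, (fun j => xi s j - approx eps del (u s) (v s) j) = y s)
    by (intro s; unfold y, pos_err; seq_ring).
  set (r1 := fun s => residual1 eps del (u s) (v s)).
  (* [dy] is the error relative to the true derivative of [X]; it differs from [w] by the omitted
     multiple of [residual1]. *)
  set (dy := fun s => sadd (w s) (sscal (- eps ^ 3) (r1 s))).
  assert (Edy : forall s, (fun j => dot xi s j - sadd (approx_vel eps del (u s) (v s))
                  (sscal (eps ^ 3) (residual1 eps del (u s) (v s))) j) = dy s)
    by (intro s; unfold dy, r1, w, vel_err; seq_ring).
  rewrite Ey, Edy in *.
  assert (H0T : Rabs 0 < T) by now rewrite Rabs_R0.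
  assert (Hy : forall s, Rabs s < T -> l2 (y s))
    by (intros s Hs; apply (dl2_pos_err _ _ _ _ _ _ _ F Hxi Hs)).
  assert (Hw : forall s, Rabs s < T -> l2 (w s))
    by (intros s Hs; apply (dl2_vel_err _ _ _ _ _ _ _ F Hxi Hs)).
  assert (Hr1 : forall s, l2 (r1 s) /\ nrm (r1 s) <= K) by (intro s; exact (proj1 (proj2 (HB' s)))).
  (* Since [eps^3 = rho * eta] with [rho <= 1], passing between [w] and [dy] costs at most
     [K * eta]. *)
  assert (Hmu' : eps ^ 3 <= eta) 
    by (rewrite Hmu, <- Hdr; assert (rho eps <= 1) by nra; clearbody eta; nra).
  assert (He3 : 0 <= eps ^ 3) by (apply pow_le; lra).
  assert (Hd : forall m s, Rabs m <= eta -> nrm (sscal m (r1 s)) <= K * eta).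
  { intros m s Hm; rewrite nrm_scal, Rmult_comm.
    apply Rmult_le_compat; [apply nrm_pos | apply Rabs_pos | apply Hr1 | exact Hm]. }
  assert (Hm1 : Rabs (eps ^ 3) <= eta) by (rewrite Rabs_pos_eq; lra).
  assert (Hm2 : Rabs (- eps ^ 3) <= eta) by now rewrite Rabs_Ropp.
  apply (close_estimate eta K L (nrm (y 0)) (nrm (dy 0)) (nrm (w 0)) (energy eps (y 0) (w 0))
           _ _ (nrm (w t)) (energy eps (y t) (w t))); trivial; try apply nrm_pos.
  - lra.
  - replace (w 0) with (sadd (dy 0) (sscal (eps ^ 3) (r1 0))) by (unfold dy; seq_ring).
    eapply Rle_trans; [apply nrm_add|].
    + apply l2_add; [now apply Hw | apply l2_scal, Hr1].
    + apply l2_scal, Hr1.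
    + apply Rplus_le_compat_l, Hd, Hm1.
  - apply energy_equiv; auto; lra.
  - apply energy_equiv; auto; lra.
  - unfold dy; eapply Rle_trans; [apply nrm_add; [now apply Hw | apply l2_scal, Hr1]|].
    apply Rplus_le_compat_l, Hd, Hm2.
  - eapply Rle_trans.
    + apply (energy_growth eps del eta K T u v xi); trivial; try lra.
    + fold c; rewrite <- Hdr; fold y w.
      assert (0 <= energy eps (y t) (w t)).
      { eapply Rle_trans; [|apply energy_equiv; auto; lra].
        pose proof (pow2_ge_0 (nrm (w t))); pose proof (pow2_ge_0 (nrm (y t))); lra. }
      assert (0 <= energy eps (y 0) (w 0)).
      { eapply Rle_trans; [|apply energy_equiv; auto; lra].
        pose proof (pow2_ge_0 (nrm (w 0))); pose proof (pow2_ge_0 (nrm (y 0))); lra. }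
      pose proof (pow2_ge_0 eta).
      do 2 (apply Rmult_le_compat_r; [lra|]).
      assert (Hexp : c * rho eps * Rabs t <= c * tau0).
      { rewrite Rmult_assoc; apply Rmult_le_compat_l; trivial.
        apply Rle_trans with (rho eps * (tau0 / rho eps)); [|right; field; lra].
        apply Rmult_le_compat_l; [lra|]; apply Rabs_le; lra. }
      unfold L; destruct Hexp as [Hexp | -> ]; [left; now apply exp_increasing | apply Rle_refl].
Qed.
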